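(* Let $\mathcal{C}$ be a $k$-linear Hom-finite Krull-Schmidt exact category and let $\alpha\colon X\to Y$ be a deflation in $\mathcal{C}$. Then $\alpha$ is right $C$-determined for some object $C$ of $\mathcal{C}$ if and only if the intrinsic kernel of $\alpha$ lies in $\mathcal{C}_l$.
   Context: Setting. $k$ is a commutative artinian ring, $\check k$ is its minimal injective cogenerator and $D=\operatorname{Hom}_k(-,\check k)$. $\mathcal{C}$ is a skeletally small, $k$-linear, Hom-finite (each $\operatorname{Hom}_{\mathcal{C}}(X,Y)$ is a finitely generated $k$-module), Krull-Schmidt (each object is a finite direct sum of objects with local endomorphism rings) exact category in the sense of Quillen: an additive category with a chosen class of kernel-cokernel pairs $X\xrightarrow{i}E\xrightarrow{d}Y$, called conflations, satisfying the usual axioms; $i$ is called an inflation and $d$ a deflation. $\operatorname{Ext}^1_{\mathcal{C}}(Y,X)$ is the $k$-module of equivalence classes of conflations $X\to E\to Y$. Stable category. A morphism $f\colon X\to Y$ is projectively trivial if for every object $Z$ the map $\operatorname{Ext}^1_{\mathcal{C}}(f,Z)\colon\operatorname{Ext}^1_{\mathcal{C}}(Y,Z)\to\operatorname{Ext}^1_{\mathcal{C}}(X,Z)$ is zero. These morphisms form an ideal $\mathcal{P}$, and $\underline{\mathcal{C}}=\mathcal{C}/\mathcal{P}$ is the projectively stable category. The subcategory $\mathcal{C}_l$. $\mathcal{C}_l$ is the full subcategory of objects $X$ such that the functor $D\operatorname{Ext}^1_{\mathcal{C}}(-,X)\colon\underline{\mathcal{C}}\to k\text{-mod}$ is representable,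 i.e. naturally isomorphic to $\underline{\operatorname{Hom}}_{\mathcal{C}}(Z,-)$ for some object $Z$, where $\underline{\operatorname{Hom}}_{\mathcal{C}}=\operatorname{Hom}_{\mathcal{C}}/\mathcal{P}$. (By a known result, this is the smallest additive subcategory containing the injective objects and the indecomposable objects which appear as the first term of an almost split conflation.) Determined morphisms. A morphism $f\colon X\to Y$ is right $C$-determined if each morphism $g\colon T\to Y$ (from any object $T$) factors through $f$ (i.e. $g=f\circ t$ for some $t\colon T\to X$), provided that for each $h\colon C\to T$ the morphism $g\circ h$ factors through $f$. Intrinsic kernel. A morphism $f\colon X\to Y$ is right minimal if each $g\in\operatorname{End}_{\mathcal{C}}(X)$ with $f\circ g=f$ is an automorphism. Morphisms $f\colon X\to Y$ and $f'\colon X'\to Y$ are right equivalent if each factors through the other. The right minimal version of $f$ is a right minimal morphism $f'\colon X'\to Y$ right equivalent to $f$ (it exists, and is unique up to isomorphism over $Y$; if $f$ is a deflation, so is $f'$). The intrinsic kernel of $f$ is $\operatorname{Ker}f'$. *)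

(* Defs.v *)
From HB Require Import structures.
From mathcomp Require Import all_boot all_order all_algebra.
From mathcomp Require Import generic_quotient ring_quotient.
From mathcomp Require Import boolp.

Set Implicit Arguments.
Unset Strict Implicit.
Unset Printing Implicit Defensive.

Import GRing.Theory.
Local Open Scope ring_scope.
Local Open Scope quotient_scope.

Definition artinian_ring (k : comPzRingType) : Prop :=
  forall I : nat -> {pred k^o},
    (forall n, submod_closed (I n)) ->
    (forall n, {subset I n.+1 <= I n}) ->
    exists N, forall n, (N <= n)%N -> I n =i I N.

Section Modules.
Variable k : comPzRingType.

Definition finitely_generated (M : lmodType k) : Prop :=
  exists (n : nat) (e : 'I_n -> M),
    forall x, exists c : 'I_n -> k, x = \sum_i c i *: e i.

Definition injective_module (J : lmodType k) : Prop :=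
  forall (U V : lmodType k) (m : {linear U -> V}) (f : {linear U -> J}),
    injective m -> exists h : {linear V -> J}, forall u, h (m u) = f u.

Definition cogenerator (J : lmodType k) : Prop :=
  forall (M : lmodType k) (x : M), x != 0 -> exists h : {linear M -> J}, h x != 0.

(* An injective cogenerator is minimal when it embeds in every other one (as a
   direct summand, since it is injective); this determines it up to
   isomorphism as the injective envelope of the sum of the simple modules. *)
Definition minimal_injective_cogenerator (J : lmodType k) : Prop :=
  [/\ injective_module J, cogenerator J &
      forall J' : lmodType k, injective_module J' -> cogenerator J' ->
        exists m : {linear J -> J'}, injective m].

Section LinearMaps.
Variables U V : lmodType k.
Local Notation L := {linear U -> V}.
Implicit Types (f g h : L) (a b : k).

HB.instance Definition _ := gen_eqMixin L.
HB.instance Definition _ := gen_choiceMixin L.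

Lemma linear_map_ext f g : f =1 g -> f = g.
Proof.
case: f => f [[p] [q]]; case: g => g [[p'] [q']] /= /funext fg.
case: _ / fg in p' q' *.
by rewrite (Prop_irrelevance p p') (Prop_irrelevance q q').
Qed.

Definition lin_zero : L := \0.
Definition lin_opp f : L := \- f.
Definition lin_add f g : L := f \+ g.
Definition lin_scale a f : L := a \*: f.

Fact lin_addA : associative lin_add.
Proof. by move=> f g h; apply: linear_map_ext => x /=; rewrite addrA. Qed.
Fact lin_addC : commutative lin_add.
Proof. by move=> f g; apply: linear_map_ext => x /=; rewrite addrC. Qed.
Fact lin_add0 : left_id lin_zero lin_add.
Proof. by move=> f; apply: linear_map_ext => x /=; rewrite add0r. Qed.
Fact lin_addN : left_inverse lin_zero lin_opp lin_add.
Proof. by move=> f; apply: linear_map_ext => x /=; rewrite addNr. Qed.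
HB.instance Definition _ :=
  GRing.isZmodule.Build L lin_addA lin_addC lin_add0 lin_addN.

Fact lin_scaleA a b f : lin_scale a (lin_scale b f) = lin_scale (a * b) f.
Proof. by apply: linear_map_ext => x /=; rewrite scalerA. Qed.
Fact lin_scale1 : left_id 1 lin_scale.
Proof. by move=> f; apply: linear_map_ext => x /=; rewrite scale1r. Qed.
Fact lin_scaleDr : right_distributive lin_scale +%R.
Proof. by move=> a f g; apply: linear_map_ext => x /=; rewrite scalerDr. Qed.
Fact lin_scaleDl f : {morph lin_scale^~ f : a b / a + b}.
Proof. by move=> a b; apply: linear_map_ext => x /=; rewrite scalerDl. Qed.
HB.instance Definition _ :=
  GRing.Zmodule_isLmodule.Build k L lin_scaleA lin_scale1 lin_scaleDr lin_scaleDl.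
End LinearMaps.

(* The duality D, when J is the minimal injective cogenerator of k. *)
Definition dual (J M : lmodType k) : lmodType k := {linear M -> J}.

Section DualMap.
Variables (J M N : lmodType k) (u : {linear M -> N}).
Definition dual_map (phi : dual J N) : dual J M := phi \o u.
Fact dual_map_is_linear : linear dual_map.
Proof. by move=> a f g; apply: linear_map_ext. Qed.
HB.instance Definition _ :=
  GRing.isLinear.Build k (dual J N) (dual J M) _ dual_map dual_map_is_linear.
End DualMap.

(* As ob is a type, skeletal smallness is automatic: the isomorphism classes
   of objects form a type. *)
Record linCat := LinCat {
  ob :> Type;
  Mor : ob -> ob -> lmodType k;
  idm : forall X, Mor X X;
  compm : forall X Y Z, Mor Y Z -> Mor X Y -> Mor X Z;
  comp1m : forall X Y (f : Mor X Y), compm (idm Y) f = f;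
  compm1 : forall X Y (f : Mor X Y), compm f (idm X) = f;
  compA : forall W X Y Z (h : Mor Y Z) (g : Mor X Y) (f : Mor W X),
    compm h (compm g f) = compm (compm h g) f;
  comp_linear_r : forall X Y Z (g : Mor Y Z), linear (fun f : Mor X Y => compm g f);
  comp_linear_l : forall X Y Z (f : Mor X Y), linear (fun g : Mor Y Z => compm g f)
}.
End Modules.

Arguments idm {k l} X.
Notation "g '\oc' f" := (compm g f) (at level 40, left associativity).

Section LinCatDefs.
Variables (k : comPzRingType) (C : linCat k).
Implicit Types A B E T X Y Z : C.

Definition Hom_finite : Prop := forall X Y, finitely_generated (Mor X Y).

Definition is_iso X Y (f : Mor X Y) : Prop :=
  exists g : Mor Y X, g \oc f = idm X /\ f \oc g = idm Y.

Definition is_kernel X E Y (i : Mor X E) (d : Mor E Y) : Prop :=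
  d \oc i = 0 /\
  forall T (t : Mor T E), d \oc t = 0 -> exists! s : Mor T X, i \oc s = t.

Definition is_cokernel X E Y (d : Mor E Y) (i : Mor X E) : Prop :=
  d \oc i = 0 /\
  forall T (t : Mor E T), t \oc i = 0 -> exists! s : Mor Y T, s \oc d = t.

Definition is_pushout A B A' B' (i : Mor A B) (f : Mor A A')
    (i' : Mor A' B') (f' : Mor B B') : Prop :=
  f' \oc i = i' \oc f /\
  forall T (u : Mor B T) (v : Mor A' T), u \oc i = v \oc f ->
    exists! w : Mor B' T, w \oc f' = u /\ w \oc i' = v.

Definition is_pullback A B A' B' (d : Mor A B) (g : Mor B' B)
    (d' : Mor A' B') (g' : Mor A' A) : Prop :=
  d \oc g' = g \oc d' /\
  forall T (u : Mor T A) (v : Mor T B'), d \oc u = g \oc v ->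
    exists! w : Mor T A', g' \oc w = u /\ d' \oc w = v.

Definition is_direct_sum n (Xs : 'I_n -> C) X
    (inj : forall i, Mor (Xs i) X) (prj : forall i, Mor X (Xs i)) : Prop :=
  [/\ forall i, prj i \oc inj i = idm (Xs i),
      forall i j, i != j -> prj j \oc inj i = 0 &
      \sum_i inj i \oc prj i = idm X].

(* The case n = 0 gives a zero object. *)
Definition additive_cat : Prop :=
  forall n (Xs : 'I_n -> C), exists X inj prj, @is_direct_sum n Xs X inj prj.

(* The non-units of End(X) form a proper additively closed subset. *)
Definition local_End X : Prop :=
  ~ is_iso (0 : Mor X X) /\
  forall f g : Mor X X, is_iso (f + g) -> is_iso f \/ is_iso g.

Definition Krull_Schmidt : Prop :=
  forall X, exists n (Xs : 'I_n -> C) inj prj,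
    @is_direct_sum n Xs X inj prj /\ forall i, local_End (Xs i).

Definition factors_through T X Y (g : Mor T Y) (f : Mor X Y) : Prop :=
  exists t : Mor T X, g = f \oc t.

Definition right_determined Z X Y (f : Mor X Y) : Prop :=
  forall T (g : Mor T Y),
    (forall h : Mor Z T, factors_through (g \oc h) f) -> factors_through g f.

Definition right_minimal X Y (f : Mor X Y) : Prop :=
  forall g : Mor X X, f \oc g = f -> is_iso g.

Definition right_equivalent X X' Y (f : Mor X Y) (f' : Mor X' Y) : Prop :=
  factors_through f f' /\ factors_through f' f.

(* The right minimal version f' of f, hence K, is unique up to isomorphism; see
   intrinsic_kernel_unique. *)
Definition is_intrinsic_kernel X Y (f : Mor X Y) (K : C) : Prop :=
  exists X' (f' : Mor X' Y) (i : Mor K X'),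
    [/\ right_minimal f', right_equivalent f f' & is_kernel i f'].

Record modFunctor := ModFunctor {
  fob :> C -> lmodType k;
  fmap : forall X Y, Mor X Y -> {linear fob X -> fob Y};
  fmap1 : forall X (x : fob X), fmap (idm X) x = x;
  fmapM : forall X Y Z (g : Mor Y Z) (f : Mor X Y) (x : fob X),
    fmap (g \oc f) x = fmap g (fmap f x)
}.

Definition naturally_isomorphic (F G : modFunctor) : Prop :=
  exists eta : forall X, {linear F X -> G X},
    (forall X, bijective (eta X)) /\
    forall X Y (f : Mor X Y) (x : F X), eta Y (fmap F f x) = fmap G f (eta X x).

Section Hom.
Variable Z : C.
Definition hom_post X Y (g : Mor X Y) (f : Mor Z X) : Mor Z Y := g \oc f.
HB.instance Definition _ X Y (g : Mor X Y) :=
  GRing.isLinear.Build k (Mor Z X) (Mor Z Y) _ (hom_post g)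
    (@comp_linear_r k C Z X Y g).

Fact hom_post1 X (f : Mor Z X) : hom_post (idm X) f = f.
Proof. exact: comp1m. Qed.
Fact hom_postM X Y W (h : Mor Y W) (g : Mor X Y) (f : Mor Z X) :
  hom_post (h \oc g) f = hom_post h (hom_post g f).
Proof. by rewrite /hom_post compA. Qed.

Definition hom_functor : modFunctor := ModFunctor hom_post1 hom_postM.
End Hom.

Definition representable (F : modFunctor) : Prop :=
  exists Z, naturally_isomorphic (hom_functor Z) F.

Section Arith.
Variables (X Y Z : C).
Lemma compDr (g : Mor Y Z) (f f' : Mor X Y) : g \oc (f + f') = g \oc f + g \oc f'.
Proof. exact: (raddfD (hom_post g)). Qed.
Lemma compBr (g : Mor Y Z) (f f' : Mor X Y) : g \oc (f - f') = g \oc f - g \oc f'.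
Proof. exact: (raddfB (hom_post g)). Qed.
Lemma compm0 (g : Mor Y Z) : g \oc (0 : Mor X Y) = 0.
Proof. exact: (raddf0 (hom_post g)). Qed.
Lemma compZr a (g : Mor Y Z) (f : Mor X Y) : g \oc (a *: f) = a *: (g \oc f).
Proof. exact: (linearZ_LR (hom_post g)). Qed.

Definition hom_pre (f : Mor X Y) (g : Mor Y Z) : Mor X Z := g \oc f.
HB.instance Definition _ (f : Mor X Y) :=
  GRing.isLinear.Build k (Mor Y Z) (Mor X Z) _ (hom_pre f)
    (@comp_linear_l k C X Y Z f).
Lemma compDl (g g' : Mor Y Z) (f : Mor X Y) : (g + g') \oc f = g \oc f + g' \oc f.
Proof. exact: (raddfD (hom_pre f)). Qed.
Lemma compBl (g g' : Mor Y Z) (f : Mor X Y) : (g - g') \oc f = g \oc f - g' \oc f.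
Proof. exact: (raddfB (hom_pre f)). Qed.
Lemma comp0m (f : Mor X Y) : (0 : Mor Y Z) \oc f = 0.
Proof. exact: (raddf0 (hom_pre f)). Qed.
Lemma compZl a (g : Mor Y Z) (f : Mor X Y) : (a *: g) \oc f = a *: (g \oc f).
Proof. exact: (linearZ_LR (hom_pre f)). Qed.
End Arith.

Lemma is_iso_id X : is_iso (idm X).
Proof. by exists (idm X); rewrite comp1m. Qed.

Lemma is_iso_comp X Y Z (g : Mor Y Z) (f : Mor X Y) :
  is_iso g -> is_iso f -> is_iso (g \oc f).
Proof.
move=> [g' [g'g gg']] [f' [f'f ff']]; exists (f' \oc g'); split.
  by rewrite -compA (compA g') g'g comp1m.
by rewrite -compA (compA f) ff' comp1m.
Qed.

Lemma is_iso_inv X Y (f : Mor X Y) : is_iso f ->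
  exists2 g, is_iso g & g \oc f = idm X /\ f \oc g = idm Y.
Proof. by move=> [g [gf fg]]; exists g => //; exists f. Qed.

Lemma kernel_mono X E Y (i : Mor X E) (d : Mor E Y) : is_kernel i d ->
  forall T (s t : Mor T X), i \oc s = i \oc t -> s = t.
Proof.
move=> [di0 ker] T s t ist.
have [|u [_ uu]] := ker T (i \oc s); first by rewrite compA di0 comp0m.
by rewrite -(uu s) // -(uu t).
Qed.

Lemma cokernel_epi X E Y (i : Mor X E) (d : Mor E Y) : is_cokernel d i ->
  forall T (s t : Mor Y T), s \oc d = t \oc d -> s = t.
Proof.
move=> [di0 cok] T s t ist.
have [|u [_ uu]] := cok T (s \oc d); first by rewrite -compA di0 compm0.
by rewrite -(uu s) // -(uu t).
Qed.

Lemma kernel_lift X E Y (i : Mor X E) (d : Mor E Y) : is_kernel i d ->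
  forall T (t : Mor T E), d \oc t = 0 -> exists s : Mor T X, i \oc s = t.
Proof. by move=> [_ ker] T t /ker[s [st _]]; exists s. Qed.

Lemma cokernel_desc X E Y (i : Mor X E) (d : Mor E Y) : is_cokernel d i ->
  forall T (t : Mor E T), t \oc i = 0 -> exists s : Mor Y T, s \oc d = t.
Proof. by move=> [_ ker] T t /ker[s [st _]]; exists s. Qed.

Lemma is_kernelI X E Y (i : Mor X E) (d : Mor E Y) :
  d \oc i = 0 ->
  (forall T (s : Mor T X), i \oc s = 0 -> s = 0) ->
  (forall T (t : Mor T E), d \oc t = 0 -> exists s : Mor T X, i \oc s = t) ->
  is_kernel i d.
Proof.
move=> di0 mono lift; split=> // T t /lift[s st]; exists s; split=> // s' s't.
by apply/subr0_eq/mono; rewrite compBr st s't subrr.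
Qed.

Lemma is_cokernelI X E Y (i : Mor X E) (d : Mor E Y) :
  d \oc i = 0 ->
  (forall T (s : Mor Y T), s \oc d = 0 -> s = 0) ->
  (forall T (t : Mor E T), t \oc i = 0 -> exists s : Mor Y T, s \oc d = t) ->
  is_cokernel d i.
Proof.
move=> di0 epi desc; split=> // T t /desc[s st]; exists s; split=> // s' s't.
by apply/subr0_eq/epi; rewrite compBl st s't subrr.
Qed.

Lemma intrinsic_kernel_unique X Y (f : Mor X Y) (K K' : C) :
  is_intrinsic_kernel f K -> is_intrinsic_kernel f K' ->
  exists u : Mor K K', is_iso u.
Proof.
move=> [X1 [f1 [i1 [min1 [[a1 fa1] [b1 fb1]] ker1]]]].
move=> [X2 [f2 [i2 [min2 [[a2 fa2] [b2 fb2]] ker2]]]].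
pose t := a2 \oc b1; pose s := a1 \oc b2.
have f2t : f2 \oc t = f1 by rewrite compA -fa2 -fb1.
have f1s : f1 \oc s = f2 by rewrite compA -fa1 -fb2.
move: t s f2t f1s => t s f2t f1s.
have [v [vst _]] : is_iso (s \oc t) by apply: min1; rewrite compA f1s f2t.
have [w [_ tsw]] : is_iso (t \oc s) by apply: min2; rewrite compA f2t f1s.
have et : t \oc (s \oc w) = idm X2 by rewrite compA.
have f1sw : f1 \oc (s \oc w) = f2 by rewrite -f2t -compA et compm1.
have swt : (s \oc w) \oc t = idm X1.
  have -> : s \oc w = v \oc s.
    by rewrite -[v \oc s]compm1 -et !compA -(compA v) vst comp1m.
  by rewrite -compA.
have [|u i2u] := kernel_lift ker2 (t := t \oc i1).
  by rewrite compA f2t; case: ker1.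
have [|u' i1u'] := kernel_lift ker1 (t := (s \oc w) \oc i2).
  by rewrite compA f1sw; case: ker2.
exists u, u'; split.
  by apply: (kernel_mono ker1); rewrite compA i1u' -compA i2u compA swt comp1m compm1.
by apply: (kernel_mono ker2); rewrite compA i2u -compA i1u' compA et comp1m compm1.
Qed.

Record biproduct X1 X2 := Biproduct {
  bp :> C;
  in1 : Mor X1 bp;
  in2 : Mor X2 bp;
  pr1 : Mor bp X1;
  pr2 : Mor bp X2;
  pr1_in1 : pr1 \oc in1 = idm X1;
  pr2_in2 : pr2 \oc in2 = idm X2;
  pr2_in1 : pr2 \oc in1 = 0;
  pr1_in2 : pr1 \oc in2 = 0;
  in_pr : in1 \oc pr1 + in2 \oc pr2 = idm bp
}.

Lemma biproduct_exists (add : additive_cat) X1 X2 : exists B : biproduct X1 X2, True.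
Proof.
have [X [inj [prj [pi1 pi0 sum1]]]] :=
  add 2%N (fun i => if val i == 0%N then X1 else X2).
pose o1 : 'I_2 := Ordinal (isT : (1 < 2)%N).
unshelve eexists; first apply: (@Biproduct X1 X2 X (inj ord0) (inj o1) (prj ord0) (prj o1)); last by [].
- exact: (pi1 ord0).
- exact: (pi1 o1).
- exact: (pi0 ord0 o1).
- exact: (pi0 o1 ord0).
rewrite -sum1 big_ord_recl big_ord1.
by have -> : lift ord0 ord0 = o1 by apply/val_inj.
Qed.
End LinCatDefs.

Arguments in1 {k C X1 X2} b.
Arguments in2 {k C X1 X2} b.
Arguments pr1 {k C X1 X2} b.
Arguments pr2 {k C X1 X2} b.

Section ExactAxioms.
Variables (k : comPzRingType) (C : linCat k).
Variable conf : forall X E Y : C, Mor X E -> Mor E Y -> Prop.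
Implicit Types A B E T X Y Z : C.

Definition inflation_of X E (i : Mor X E) : Prop :=
  exists Y (d : Mor E Y), conf i d.
Definition deflation_of E Y (d : Mor E Y) : Prop :=
  exists X (i : Mor X E), conf i d.

Record exact_axioms : Prop := ExactAxioms {
  conf_kernel : forall X E Y (i : Mor X E) (d : Mor E Y),
    conf i d -> is_kernel i d;
  conf_cokernel : forall X E Y (i : Mor X E) (d : Mor E Y),
    conf i d -> is_cokernel d i;
  conf_iso : forall X E Y X' E' Y' (i : Mor X E) (d : Mor E Y)
      (i' : Mor X' E') (d' : Mor E' Y')
      (a : Mor X X') (b : Mor E E') (c : Mor Y Y'),
    is_iso a -> is_iso b -> is_iso c -> b \oc i = i' \oc a -> c \oc d = d' \oc b ->
    conf i d -> conf i' d';
  inflation_id : forall X, inflation_of (idm X);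
  deflation_id : forall X, deflation_of (idm X);
  inflation_comp : forall X Y Z (j : Mor Y Z) (i : Mor X Y),
    inflation_of j -> inflation_of i -> inflation_of (j \oc i);
  deflation_comp : forall X Y Z (e : Mor Y Z) (d : Mor X Y),
    deflation_of e -> deflation_of d -> deflation_of (e \oc d);
  inflation_pushout : forall X E X' (i : Mor X E) (f : Mor X X'), inflation_of i ->
    exists E' (i' : Mor X' E') (f' : Mor E E'),
      is_pushout i f i' f' /\ inflation_of i';
  deflation_pullback : forall E Y Y' (d : Mor E Y) (g : Mor Y' Y), deflation_of d ->
    exists E' (d' : Mor E' Y') (g' : Mor E' E),
      is_pullback d g d' g' /\ deflation_of d'
}.
End ExactAxioms.

Record exactCat (k : comPzRingType) := ExactCat {
  exact_lin :> linCat k;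
  exact_additive : additive_cat exact_lin;
  conflation : forall X E Y : exact_lin, Mor X E -> Mor E Y -> Prop;
  exactP : exact_axioms conflation
}.

Arguments conflation {k e X E Y} i d.
Arguments exact_additive {k} e.

Section Ext.
Variables (k : comPzRingType) (C : exactCat k).
Implicit Types A B T X Y Z : C.

Definition inflation X (E : C) (i : Mor X E) : Prop := inflation_of (@conflation k C) i.
Definition deflation (E : C) Y (d : Mor E Y) : Prop := deflation_of (@conflation k C) d.

Record extension Y X := Extension {
  mid : C;
  inc : Mor X mid;
  prj : Mor mid Y;
  extP : conflation inc prj
}.

Definition ext_equiv Y X (E E' : extension Y X) : Prop :=
  exists e : Mor (mid E) (mid E'), [/\ is_iso e, e \oc inc E = inc E' & prj E' \oc e = prj E].

Definition ext_equivb Y X : rel (extension Y X) := fun E E' => `[< ext_equiv E E' >].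

HB.instance Definition _ Y X := gen_eqMixin (extension Y X).
HB.instance Definition _ Y X := gen_choiceMixin (extension Y X).

Fact ext_equiv_is_equiv Y X : equiv_class_of (@ext_equivb Y X).
Proof.
split=> [E|E E'|E2 E1 E3].
- by apply/asboolP; exists (idm _); rewrite comp1m compm1; split=> //; exact: is_iso_id.
- apply/asboolP/asboolP.
    move=> [e [/is_iso_inv[g gi [ge eg]] ei pe]]; exists g; split=> //.
      by rewrite -ei compA ge comp1m.
    by rewrite -pe -compA eg compm1.
  move=> [e [/is_iso_inv[g gi [ge eg]] ei pe]]; exists g; split=> //.
    by rewrite -ei compA ge comp1m.
  by rewrite -pe -compA eg compm1.
- move=> /asboolP[e [ei e1 e2]] /asboolP[f [fi f1 f2]]; apply/asboolP.
  exists (f \oc e); split; first exact: is_iso_comp.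
    by rewrite -compA e1.
  by rewrite compA f2.
Qed.

Canonical ext_equiv_equiv Y X := EquivRelPack (@ext_equiv_is_equiv Y X).
Canonical ext_equiv_encModRel Y X := defaultEncModRel (@ext_equivb Y X).

Definition Ext1 Y X := {eq_quot (@ext_equivb Y X)}.
HB.instance Definition _ Y X : EqQuotient _ (@ext_equivb Y X) (Ext1 Y X) :=
  EqQuotient.on (Ext1 Y X).
HB.instance Definition _ Y X := Choice.on (Ext1 Y X).

Lemma ext_eqP Y X (E E' : extension Y X) :
  (\pi_(Ext1 Y X) E = \pi_(Ext1 Y X) E') <-> ext_equiv E E'.
Proof. by split=> [/eqmodP/asboolP //|h]; apply/eqmodP/asboolP. Qed.

(* Morphisms of conflations with prescribed outer components. *)
Definition ext_mor X X' Y Y' (f : Mor X X') (g : Mor Y Y')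
    (E : extension Y X) (E' : extension Y' X') : Prop :=
  exists e : Mor (mid E) (mid E'), e \oc inc E = inc E' \oc f /\ prj E' \oc e = g \oc prj E.

Section Conflations.
Context (X Y : C) (E : extension Y X).
Lemma ext_ker : is_kernel (inc E) (prj E).
Proof. exact: conf_kernel (exactP C) _ _ _ _ _ (extP E). Qed.
Lemma ext_cok : is_cokernel (prj E) (inc E).
Proof. exact: conf_cokernel (exactP C) _ _ _ _ _ (extP E). Qed.
Lemma prj_inc : prj E \oc inc E = 0.
Proof. by case: ext_ker. Qed.
Lemma inflation_inc : inflation (inc E).
Proof. by exists Y, (prj E); exact: extP. Qed.
Lemma deflation_prj : deflation (prj E).
Proof. by exists X, (inc E); exact: extP. Qed.
End Conflations.

Lemma deflation_kernel X (E : C) Y (i : Mor X E) (d : Mor E Y) :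
  deflation d -> is_kernel i d -> conflation i d.
Proof.
move=> [X' [i' id']] ker; have ker' := conf_kernel (exactP C) id'.
have [u iu] := kernel_lift ker ker'.1.
have [v i'v] := kernel_lift ker' ker.1.
apply: (conf_iso (exactP C) _ (is_iso_id E) (is_iso_id Y) _ _ id' (a := u)).
- exists v; split.
    by apply: (kernel_mono ker'); rewrite compA i'v iu compm1.
  by apply: (kernel_mono ker); rewrite compA iu i'v compm1.
- by rewrite comp1m iu.
- by rewrite comp1m compm1.
Qed.

Lemma inflation_cokernel X (E : C) Y (i : Mor X E) (d : Mor E Y) :
  inflation i -> is_cokernel d i -> conflation i d.
Proof.
move=> [Y' [d' id']] cok; have cok' := conf_cokernel (exactP C) id'.
have [u ud] := cokernel_desc cok cok'.1.
have [v vd'] := cokernel_desc cok' cok.1.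
apply: (conf_iso (exactP C) (is_iso_id X) (is_iso_id E) _ _ _ id' (c := v)).
- exists u; split.
    by apply: (cokernel_epi cok'); rewrite -compA vd' ud comp1m.
  by apply: (cokernel_epi cok); rewrite -compA ud vd' comp1m.
- by rewrite comp1m compm1.
- by rewrite compm1 vd'.
Qed.

(* The short five lemma. *)
Lemma ext_mor11 Y X (E E' : extension Y X) :
  ext_mor (idm X) (idm Y) E E' -> ext_equiv E E'.
Proof.
move=> [e []]; rewrite compm1 comp1m => ei pe; exists e; split=> //.
have mono T (t : Mor T (mid E)) : e \oc t = 0 -> t = 0.
  move=> et0; have /(kernel_lift (ext_ker E))[s st] : prj E \oc t = 0.
    by rewrite -pe -compA et0 compm0.
  suff -> : t = inc E \oc 0 by rewrite compm0.
  rewrite -st; congr (_ \oc _); apply: (kernel_mono (ext_ker E')).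
  by rewrite -ei -compA st et0 compm0.
have [Q [q2 [q1 [[pq _] [K [i confi]]]]]] :=
  deflation_pullback (exactP C) (prj E') (deflation_prj E).
have [s is_] : exists s, inc E' \oc s = q2 - e \oc q1.
  apply: (kernel_lift (ext_ker E')).
  by rewrite compBr compA pe pq subrr.
pose r := q1 + inc E \oc s.
have er : e \oc r = q2 by rewrite compDr compA ei is_ addrC subrK.
have cok := conf_cokernel (exactP C) confi.
have [u uq] : exists u, u \oc q2 = r.
  by apply: (cokernel_desc cok); apply: mono; rewrite compA er; case: cok.
have eu : e \oc u = idm _.
  by apply: (cokernel_epi cok); rewrite -compA uq er comp1m.
exists u; split=> //; apply/subr0_eq/mono.
by rewrite compBr compA eu comp1m compm1 subrr.
Qed.

Lemma ext_mor_comp X1 X2 X3 Y1 Y2 Y3 (f : Mor X1 X2) (f' : Mor X2 X3)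
    (g : Mor Y1 Y2) (g' : Mor Y2 Y3)
    (E1 : extension Y1 X1) (E2 : extension Y2 X2) (E3 : extension Y3 X3) :
  ext_mor f g E1 E2 -> ext_mor f' g' E2 E3 -> ext_mor (f' \oc f) (g' \oc g) E1 E3.
Proof.
move=> [e [ei pe]] [e' [ei' pe']]; exists (e' \oc e); split.
  by rewrite -compA ei compA ei' compA.
by rewrite compA pe' -compA pe compA.
Qed.

Lemma ext_equiv_mor X Y (E E' : extension Y X) :
  ext_equiv E E' -> ext_mor (idm X) (idm Y) E E'.
Proof. by move=> [e [_ ei pe]]; exists e; rewrite compm1 comp1m. Qed.

Lemma ext_pushE X X' Y (f : Mor X X') (E : extension Y X) :
  exists2 E' : extension Y X', ext_mor f (idm Y) E E' &
    forall Y1 (g : Mor Y Y1) (E1 : extension Y1 X'),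
      ext_mor f g E E1 -> ext_mor (idm X') g E' E1.
Proof.
have [P [j [h [[hj univ] infl_j]]]] :=
  inflation_pushout (exactP C) f (inflation_inc E).
have [d [[dh dj] _]] : exists! w : Mor P Y, w \oc h = prj E /\ w \oc j = 0.
  by apply: univ; rewrite prj_inc comp0m.
have joint T (s t : Mor P T) : s \oc h = t \oc h -> s \oc j = t \oc j -> s = t.
  move=> sth stj; have [|w [_ uw]] := univ T (s \oc h) (s \oc j).
    by rewrite -!compA hj.
  by rewrite -(uw s) // -(uw t).
have cok : is_cokernel d j.
  apply: is_cokernelI => // T.
    move=> s sd; apply: (cokernel_epi (ext_cok E)).
    by rewrite -dh compA sd !comp0m.
  move=> t tj; have [|s st] := cokernel_desc (ext_cok E) (t := t \oc h).
    by rewrite -compA hj compA tj comp0m.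
  exists s; apply: joint; first by rewrite -compA dh.
  by rewrite -compA dj compm0 tj.
exists (Extension (inflation_cokernel infl_j cok)) => /=.
  by exists h; rewrite /= comp1m.
move=> Y1 g E1 [e [ei pe]].
have [|w [[wh wj] _]] := univ _ e (inc E1); first by [].
exists w; rewrite /= compm1; split=> //; apply: joint.
  by rewrite -!compA wh dh.
by rewrite -!compA wj dj compm0 prj_inc.
Qed.

Lemma ext_pullE X Y Y' (g : Mor Y' Y) (E : extension Y X) :
  exists2 E' : extension Y' X, ext_mor (idm X) g E' E &
    forall E1 : extension Y' X, ext_mor (idm X) g E1 E -> ext_mor (idm X) (idm Y') E1 E'.
Proof.
have [P [d [h [[dh univ] defl_d]]]] :=
  deflation_pullback (exactP C) g (deflation_prj E).
have [j [[hj dj] _]] : exists! w : Mor X P, h \oc w = inc E /\ d \oc w = 0.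
  by apply: univ; rewrite prj_inc compm0.
have joint T (s t : Mor T P) : h \oc s = h \oc t -> d \oc s = d \oc t -> s = t.
  move=> sth std; have [|w [_ uw]] := univ T (h \oc s) (d \oc s).
    by rewrite !compA dh.
  by rewrite -(uw s) // -(uw t).
have ker : is_kernel j d.
  apply: is_kernelI => // T.
    move=> s js; apply: (kernel_mono (ext_ker E)).
    by rewrite -hj -compA js !compm0.
  move=> t dt; have [|s st] := kernel_lift (ext_ker E) (t := h \oc t).
    by rewrite compA dh -compA dt compm0.
  exists s; apply: joint; first by rewrite compA hj.
  by rewrite compA dj comp0m dt.
exists (Extension (deflation_kernel defl_d ker)) => /=.
  by exists h; rewrite /= compm1.
move=> E1 [e [ei pe]].
have [|w [[hw dw] _]] := univ _ e (prj E1); first by [].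
exists w; rewrite /= compm1 comp1m; split=> //; apply: joint.
  by rewrite compA hw ei compm1 hj.
by rewrite compA dw prj_inc dj.
Qed.

(* Ext^1(Y, f) and Ext^1(g, X), for f : X -> X' and g : Y' -> Y. *)
Definition push X X' Y (f : Mor X X') (x : Ext1 Y X) : Ext1 Y X' :=
  \pi_(Ext1 Y X') (s2val (cid2 (ext_pushE f (repr x)))).
Definition pull X Y Y' (g : Mor Y' Y) (x : Ext1 Y X) : Ext1 Y' X :=
  \pi_(Ext1 Y' X) (s2val (cid2 (ext_pullE g (repr x)))).

Definition emor X X' Y Y' (f : Mor X X') (g : Mor Y Y')
  (x : Ext1 Y X) (x' : Ext1 Y' X') : Prop := ext_mor f g (repr x) (repr x').

Lemma emor_pi X X' Y Y' (f : Mor X X') (g : Mor Y Y') E E' :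
  emor f g (\pi_(Ext1 Y X) E) (\pi_(Ext1 Y' X') E') <-> ext_mor f g E E'.
Proof.
have to X1 Y1 (F : extension Y1 X1) :
    ext_mor (idm X1) (idm Y1) (repr (\pi_(Ext1 Y1 X1) F)) F.
  by apply/ext_equiv_mor/ext_eqP; rewrite reprK.
have from X1 Y1 (F : extension Y1 X1) :
    ext_mor (idm X1) (idm Y1) F (repr (\pi_(Ext1 Y1 X1) F)).
  by apply/ext_equiv_mor/ext_eqP; rewrite reprK.
split=> h.
  by have := ext_mor_comp (from _ _ E) (ext_mor_comp h (to _ _ E')); rewrite !comp1m !compm1.
by have := ext_mor_comp (to _ _ E) (ext_mor_comp h (from _ _ E')); rewrite !comp1m !compm1.
Qed.

Lemma emor_comp X1 X2 X3 Y1 Y2 Y3 (f : Mor X1 X2) (f' : Mor X2 X3)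
    (g : Mor Y1 Y2) (g' : Mor Y2 Y3) x1 x2 x3 :
  emor f g x1 x2 -> emor f' g' x2 x3 -> emor (f' \oc f) (g' \oc g) x1 x3.
Proof. exact: ext_mor_comp. Qed.

Lemma emor11 X Y (x y : Ext1 Y X) : emor (idm X) (idm Y) x y -> x = y.
Proof. by move=> /ext_mor11/ext_eqP; rewrite !reprK. Qed.

Lemma emor_refl X Y (x : Ext1 Y X) : emor (idm X) (idm Y) x x.
Proof. by exists (idm _); rewrite !comp1m !compm1. Qed.

Lemma emor_push X X' Y (f : Mor X X') (x : Ext1 Y X) : emor f (idm Y) x (push f x).
Proof.
rewrite -{1}[x]reprK /push; apply/emor_pi; by case: cid2.
Qed.

Lemma emor_pull X Y Y' (g : Mor Y' Y) (x : Ext1 Y X) : emor (idm X) g (pull g x) x.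
Proof.
rewrite -{2}[x]reprK /pull; apply/emor_pi; by case: cid2.
Qed.

(* A morphism of conflations (f, e, g) from x to y yields f_* x = g^* y. *)
Lemma push_pull X X' Y Y' (f : Mor X X') (g : Mor Y Y') x y :
  emor f g x y -> push f x = pull g y.
Proof.
move=> h; apply: emor11; apply/emor_pi.
case: cid2 => E _ /= univ; case: cid2 => F _ /=; apply; exact: univ.
Qed.

Lemma pull1 X Y (x : Ext1 Y X) : pull (idm Y) x = x.
Proof. exact/emor11/emor_pull. Qed.

Lemma push1 X Y (x : Ext1 Y X) : push (idm X) x = x.
Proof. by rewrite (push_pull (emor_refl x)) pull1. Qed.

Lemma pushE X X' Y (f : Mor X X') (x : Ext1 Y X) y :
  emor f (idm Y) x y -> push f x = y.
Proof. by move/push_pull; rewrite pull1. Qed.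

Lemma pullE X Y Y' (g : Mor Y' Y) (x : Ext1 Y X) y :
  emor (idm X) g y x -> pull g x = y.
Proof. by move/push_pull; rewrite push1. Qed.

Lemma pushM X X' X'' Y (f' : Mor X' X'') (f : Mor X X') (x : Ext1 Y X) :
  push (f' \oc f) x = push f' (push f x).
Proof.
by apply: pushE; rewrite -[idm Y]comp1m; exact: emor_comp (emor_push _ _) (emor_push _ _).
Qed.

Lemma pullM X Y Y' Y'' (g : Mor Y' Y) (g' : Mor Y'' Y') (x : Ext1 Y X) :
  pull (g \oc g') x = pull g' (pull g x).
Proof.
by apply: pullE; rewrite -[idm X]comp1m; exact: emor_comp (emor_pull _ _) (emor_pull _ _).
Qed.

Lemma pullC X X' Y Y' (f : Mor X X') (g : Mor Y' Y) (x : Ext1 Y X) :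
  push f (pull g x) = pull g (push f x).
Proof.
apply: push_pull; have := emor_comp (emor_pull g x) (emor_push f x).
by rewrite compm1 comp1m.
Qed.

Section Pairing.
Variables (X1 X2 : C) (B : biproduct X1 X2).
Local Notation p1 := (pr1 B).
Local Notation p2 := (pr2 B).
Local Notation i1 := (in1 B).
Local Notation i2 := (in2 B).

(* The middle term of the extension below is the fibre product over Y of the
   middle terms of E1 and E2. *)
Lemma pairE Y (E1 : extension Y X1) (E2 : extension Y X2) :
  exists P : extension Y B, exists (q1 : Mor (mid P) (mid E1)) (q2 : Mor (mid P) (mid E2)),
    [/\ q1 \oc inc P = inc E1 \oc p1 /\ prj E1 \oc q1 = prj P,
        q2 \oc inc P = inc E2 \oc p2 /\ prj E2 \oc q2 = prj P &
        forall F : extension Y B, ext_mor p1 (idm Y) F E1 -> ext_mor p2 (idm Y) F E2 ->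
          ext_mor (idm B) (idm Y) F P].
Proof.
have [P [q1 [q2 [[q12 univ] defl_q1]]]] :=
  deflation_pullback (exactP C) (prj E1) (deflation_prj E2).
have joint T (s t : Mor T P) : q1 \oc s = q1 \oc t -> q2 \oc s = q2 \oc t -> s = t.
  move=> s1 s2; have [|w [_ uw]] := univ T (q2 \oc s) (q1 \oc s).
    by rewrite !compA q12.
  by rewrite -(uw s) // -(uw t).
have [c [[c2 c1] _]] : exists! w : Mor B P, q2 \oc w = inc E2 \oc p2 /\ q1 \oc w = inc E1 \oc p1.
  by apply: univ; rewrite !compA !prj_inc !comp0m.
have defl := deflation_comp (exactP C) (deflation_prj E1) defl_q1.
have ker : is_kernel c (prj E1 \oc q1).
  apply: is_kernelI => [|T s cs|T t dt].
  - by rewrite -compA c1 compA prj_inc comp0m.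
  - have s1 : p1 \oc s = 0.
      apply: (kernel_mono (ext_ker E1)).
      by rewrite compA -c1 -compA cs !compm0.
    have s2 : p2 \oc s = 0.
      apply: (kernel_mono (ext_ker E2)).
      by rewrite compA -c2 -compA cs !compm0.
    by rewrite -[s]comp1m -(in_pr B) compDl -!compA s1 s2 !compm0 addr0.
  - have [|s1 e1] := kernel_lift (ext_ker E1) (t := q1 \oc t); first by rewrite compA.
    have [|s2 e2] := kernel_lift (ext_ker E2) (t := q2 \oc t).
      by rewrite compA q12.
    exists (i1 \oc s1 + i2 \oc s2); apply: joint.
      by rewrite compA c1 compDr -!compA (compA p1) (compA p1) pr1_in1 pr1_in2 comp1m comp0m compm0 addr0.
    by rewrite compA c2 compDr -!compA (compA p2) (compA p2) pr2_in1 pr2_in2 comp1m comp0m compm0 add0r.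
exists (Extension (deflation_kernel defl ker)), q1, q2; split=> //=.
move=> F [e1 [ei1 pe1]] [e2 [ei2 pe2]].
rewrite comp1m in pe1; rewrite comp1m in pe2.
have [|w [[w2 w1] _]] := univ _ e2 e1; first by rewrite pe2.
exists w; rewrite /= compm1 comp1m; split; last by rewrite -compA w1.
by apply: joint; rewrite compA ?w1 ?w2 ?c1 ?c2.
Qed.

Lemma pair_exists Y (x1 : Ext1 Y X1) (x2 : Ext1 Y X2) :
  exists x : Ext1 Y B, push p1 x = x1 /\ push p2 x = x2.
Proof.
have [P [q1 [q2 [h1 h2 _]]]] := pairE (repr x1) (repr x2).
exists (\pi_(Ext1 Y B) P); split; apply: pushE.
  by rewrite -[x1]reprK; apply/emor_pi; exists q1; rewrite comp1m.
by rewrite -[x2]reprK; apply/emor_pi; exists q2; rewrite comp1m.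
Qed.

Lemma pair_inj Y (x y : Ext1 Y B) :
  push p1 x = push p1 y -> push p2 x = push p2 y -> x = y.
Proof.
have [P [q1 [q2 [_ _ univ]]]] := pairE (repr (push p1 y)) (repr (push p2 y)).
move=> e1 e2.
have Py : y = \pi_(Ext1 Y B) P.
  by apply: emor11; rewrite -[y]reprK; apply/emor_pi; apply: univ; apply: emor_push.
rewrite Py; apply: emor11; rewrite -[x]reprK; apply/emor_pi; apply: univ.
  by rewrite -e1; exact: emor_push.
by rewrite -e2; exact: emor_push.
Qed.

Lemma split_conflation : conflation i1 p2.
Proof.
have [Z [d confd]] := inflation_id (exactP C) X1.
have d0 : d = 0 by have [+ _] := conf_cokernel (exactP C) confd; rewrite compm1.
have defl_d : deflation d by exists X1, (idm X1).
have [P [q2 [q1 [[q12 univ] [K [i confi]]]]]] :=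
  deflation_pullback (exactP C) (0 : Mor X2 Z) defl_d.
have joint T (s t : Mor T P) : q1 \oc s = q1 \oc t -> q2 \oc s = q2 \oc t -> s = t.
  move=> s1 s2; have [|w [_ uw]] := univ T (q1 \oc s) (q2 \oc s).
    by rewrite !compA q12.
  by rewrite -(uw s) // -(uw t).
have [w [[w1 w2] _]] : exists! w : Mor B P, q1 \oc w = p1 /\ q2 \oc w = p2.
  by apply: univ; rewrite d0 !comp0m.
pose v := i1 \oc q1 + i2 \oc q2.
have p2v : p2 \oc v = q2.
  by rewrite compDr !compA pr2_in1 pr2_in2 comp0m comp1m add0r.
have p1v : p1 \oc v = q1.
  by rewrite compDr !compA pr1_in1 pr1_in2 comp0m comp1m addr0.
apply: deflation_kernel.
  exists K, (v \oc i).
  apply: (conf_iso (exactP C) (is_iso_id K) _ (is_iso_id X2) _ _ confi (b := v)).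
  - exists w; split; last by rewrite compDl -!compA w1 w2 in_pr.
    by apply: joint; rewrite compA compm1 ?w1 ?w2.
  - by rewrite compm1.
  - by rewrite comp1m p2v.
apply: is_kernelI => [|T s is0|T t pt0]; first exact: pr2_in1.
  by rewrite -[s]comp1m -(pr1_in1 B) -compA is0 compm0.
exists (p1 \oc t).
by rewrite compA -[RHS]comp1m -(in_pr B) compDl -(compA i2) pt0 compm0 addr0.
Qed.
End Pairing.

Section ExtModule.
Variables Y X : C.
Implicit Types (x y z : Ext1 Y X) (a b : k).

Definition biprod X1 X2 : biproduct X1 X2 :=
  projT1 (cid (biproduct_exists (exact_additive C) X1 X2)).

(* The element of Ext^1(Y, X (+) X) with components x and y, that is, the
   pullback of the direct sum of x and y along the diagonal of Y. *)
Definition ext_pair x y : Ext1 Y (biprod X X) :=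
  projT1 (cid (pair_exists (biprod X X) x y)).

Definition ext_zero : Ext1 Y X :=
  \pi_(Ext1 Y X) (Extension (split_conflation (biprod X Y))).
Definition ext_opp x : Ext1 Y X := push (- idm X) x.
(* The Baer sum. *)
Definition ext_add x y : Ext1 Y X :=
  push (pr1 (biprod X X) + pr2 (biprod X X)) (ext_pair x y).
Definition ext_scale a x : Ext1 Y X := push (a *: idm X) x.

Lemma push0 Z (e : Ext1 Y Z) : push (0 : Mor Z X) e = ext_zero.
Proof.
apply: pushE; rewrite -[e]reprK; apply/emor_pi => /=.
exists (in2 (biprod X Y) \oc prj (repr e)) => /=; rewrite comp1m compm0.
by rewrite -compA prj_inc compm0 compA pr2_in2 comp1m.
Qed.

Lemma ext_addE Z (f g : Mor Z X) (e : Ext1 Y Z) :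
  ext_add (push f e) (push g e) = push (f + g) e.
Proof.
rewrite /ext_add /ext_pair; case: cid => w [w1 w2] /=; set B := biprod X X in w w1 w2 *.
have -> : w = push (in1 B \oc f + in2 B \oc g) e.
  apply: (pair_inj (B := B)); rewrite -pushM compDr !compA.
    by rewrite pr1_in1 pr1_in2 comp0m comp1m addr0.
  by rewrite pr2_in1 pr2_in2 comp0m comp1m add0r.
rewrite -pushM compDl !compDr !compA pr1_in1 pr1_in2 pr2_in1 pr2_in2.
by rewrite !comp0m !comp1m addr0 add0r.
Qed.

Lemma ext_joint2 x y : exists Z (e : Ext1 Y Z) (f g : Mor Z X),
  x = push f e /\ y = push g e.
Proof.
have [e [e1 e2]] := pair_exists (biprod X X) x y.
by exists (biprod X X), e, (pr1 _), (pr2 _).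
Qed.

Lemma ext_joint3 x y z : exists Z (e : Ext1 Y Z) (f g h : Mor Z X),
  [/\ x = push f e, y = push g e & z = push h e].
Proof.
have [Z [e [f [g [xf yg]]]]] := ext_joint2 x y.
have [e' [e1 e2]] := pair_exists (biprod Z X) e z.
exists (biprod Z X), e', (f \oc pr1 _), (g \oc pr1 _), (pr2 _).
by rewrite !pushM e1.
Qed.

Fact ext_addA : associative ext_add.
Proof.
move=> x y z; have [Z [e [f [g [h [-> -> ->]]]]]] := ext_joint3 x y z.
by rewrite !ext_addE addrA.
Qed.
Fact ext_addC : commutative ext_add.
Proof.
move=> x y; have [Z [e [f [g [-> ->]]]]] := ext_joint2 x y.
by rewrite !ext_addE addrC.
Qed.
Fact ext_add0 : left_id ext_zero ext_add.
Proof. by move=> x; rewrite -[x in LHS]push1 -(push0 x) ext_addE add0r push1. Qed.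
Fact ext_addN : left_inverse ext_zero ext_opp ext_add.
Proof. by move=> x; rewrite /ext_opp -{2}[x]push1 -(push0 x) ext_addE addNr. Qed.
HB.instance Definition _ :=
  GRing.isZmodule.Build (Ext1 Y X) ext_addA ext_addC ext_add0 ext_addN.

Fact ext_scaleA a b x : ext_scale a (ext_scale b x) = ext_scale (a * b) x.
Proof. by rewrite /ext_scale -pushM compZl comp1m scalerA. Qed.
Fact ext_scale1 : left_id 1 ext_scale.
Proof. by move=> x; rewrite /ext_scale scale1r push1. Qed.
Fact ext_scaleDr : right_distributive ext_scale +%R.
Proof.
move=> a x y; have [Z [e [f [g [-> ->]]]]] := ext_joint2 x y.
have addE (u v : Ext1 Y X) : u + v = ext_add u v by [].
by rewrite /ext_scale !addE ext_addE -!pushM ext_addE compDr.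
Qed.
Fact ext_scaleDl x : {morph ext_scale^~ x : a b / a + b}.
Proof. by move=> a b; rewrite /ext_scale scalerDl -ext_addE. Qed.
HB.instance Definition _ := GRing.Zmodule_isLmodule.Build k (Ext1 Y X)
  ext_scaleA ext_scale1 ext_scaleDr ext_scaleDl.
End ExtModule.

Lemma push_add X Y Z (f g : Mor Z X) (e : Ext1 Y Z) :
  push (f + g) e = push f e + push g e.
Proof. by rewrite -ext_addE. Qed.

Lemma ext_scaleE X Y a (x : Ext1 Y X) : a *: x = push (a *: idm X) x.
Proof. by []. Qed.

Lemma ext_zeroE X Y : (0 : Ext1 Y X) = ext_zero Y X.
Proof. by []. Qed.

Fact pull_is_linear X Y Y' (g : Mor Y' Y) : linear (@pull X Y Y' g).
Proof.
move=> a x y; have [Z [e [f [h [-> ->]]]]] := ext_joint2 x y.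
by rewrite !ext_scaleE -pushM -push_add -!pullC -pushM -push_add.
Qed.
HB.instance Definition _ X Y Y' (g : Mor Y' Y) := GRing.isLinear.Build k
  (Ext1 Y X) (Ext1 Y' X) _ (@pull X Y Y' g) (@pull_is_linear X Y Y' g).

Lemma emor_add X X' Y Y' (u v : Mor X X') (f g : Mor Y Y') x y :
  emor u f x y -> emor v g x y -> emor (u + v) (f + g) x y.
Proof.
move=> [e [ei pe]] [e' [ei' pe']]; exists (e + e').
by rewrite compDl !compDr compDl ei ei' pe pe'.
Qed.

Lemma emor_scale X X' Y Y' a (u : Mor X X') (f : Mor Y Y') x y :
  emor u f x y -> emor (a *: u) (a *: f) x y.
Proof. by move=> [e [ei pe]]; exists (a *: e); rewrite !compZl !compZr ei pe. Qed.

Lemma pull_add X Y Y' (f g : Mor Y' Y) (x : Ext1 Y X) :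
  pull (f + g) x = pull f x + pull g x.
Proof.
have [e [ef eg]] := pair_exists (biprod X X) (pull f x) (pull g x).
rewrite -ef -eg -push_add; symmetry; apply: push_pull; apply: emor_add.
  have := emor_comp (emor_push (pr1 (biprod X X)) e) (_ : emor (idm X) f _ x).
  by rewrite comp1m compm1; apply; rewrite ef; exact: emor_pull.
have := emor_comp (emor_push (pr2 (biprod X X)) e) (_ : emor (idm X) g _ x).
by rewrite comp1m compm1; apply; rewrite eg; exact: emor_pull.
Qed.

Lemma pull_scale X Y Y' a (f : Mor Y' Y) (x : Ext1 Y X) :
  pull (a *: f) x = a *: pull f x.
Proof. by symmetry; apply: push_pull; exact: emor_scale (emor_pull f x). Qed.

Definition projectively_trivial X Y (f : Mor X Y) : Prop :=
  forall Z (x : Ext1 Y Z), pull f x = 0.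

Definition ptriv X Y : {pred Mor X Y} := fun f => `[< projectively_trivial f >].
Arguments ptriv : clear implicits.

Lemma ptrivP X Y (f : Mor X Y) : reflect (projectively_trivial f) (f \in ptriv X Y).
Proof. exact: asboolP. Qed.

Fact ptriv_submod X Y : submod_closed (ptriv X Y).
Proof.
have lin a (f g : Mor X Y) : f \in ptriv X Y -> g \in ptriv X Y -> a *: f + g \in ptriv X Y.
  move=> /ptrivP f0 /ptrivP g0; apply/ptrivP => Z x.
  by rewrite pull_add pull_scale f0 g0 scaler0 addr0.
split; last by move=> a f g; exact: lin.
by apply/ptrivP => Z x; rewrite -(scale0r (0 : Mor X Y)) pull_scale scale0r.
Qed.
HB.instance Definition _ X Y :=
  GRing.isZmodClosed.Build (Mor X Y) (ptriv X Y) (GRing.submod_closedB (ptriv_submod X Y)).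

Lemma ptrivZ X Y a (f : Mor X Y) : f \in ptriv X Y -> a *: f \in ptriv X Y.
Proof. by move=> /ptrivP f0; apply/ptrivP => Z x; rewrite pull_scale f0 scaler0. Qed.

Lemma ptriv_compl X Y Z (g : Mor Y Z) (f : Mor X Y) :
  f \in ptriv X Y -> g \oc f \in ptriv X Z.
Proof. by move=> /ptrivP f0; apply/ptrivP => W x; rewrite pullM f0. Qed.

Lemma ptriv_compr X Y Z (g : Mor Y Z) (f : Mor X Y) :
  g \in ptriv Y Z -> g \oc f \in ptriv X Z.
Proof. by move=> /ptrivP g0; apply/ptrivP => W x; rewrite pullM g0 raddf0. Qed.

Definition stable_hom X Y := Quotient.quot (ptriv X Y).
HB.instance Definition _ X Y := GRing.Zmodule.on (stable_hom X Y).
HB.instance Definition _ X Y := ZmodQuotient.on (stable_hom X Y).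

Lemma stable_eqP X Y (f g : Mor X Y) :
  reflect (\pi_(stable_hom X Y) f = \pi_(stable_hom X Y) g) (f - g \in ptriv X Y).
Proof. by rewrite Quotient.idealrBE; exact: eqP. Qed.

Lemma stable_repr X Y (f : Mor X Y) : repr (\pi_(stable_hom X Y) f) - f \in ptriv X Y.
Proof. by apply/stable_eqP; rewrite reprK. Qed.

Lemma stable_addE X Y (f g : Mor X Y) :
  \pi_(stable_hom X Y) f + \pi_(stable_hom X Y) g = \pi_(stable_hom X Y) (f + g).
Proof. by rewrite raddfD. Qed.

Section StableModule.
Variables X Y : C.
Implicit Types (u v : stable_hom X Y) (a b : k).

Definition stable_scale a u : stable_hom X Y := \pi_(stable_hom X Y) (a *: repr u).

Lemma stable_scaleE a (f : Mor X Y) :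
  stable_scale a (\pi_(stable_hom X Y) f) = \pi_(stable_hom X Y) (a *: f).
Proof. by apply/stable_eqP; rewrite -scalerBr; exact: ptrivZ (stable_repr _). Qed.

Fact stable_scaleA a b u : stable_scale a (stable_scale b u) = stable_scale (a * b) u.
Proof. by rewrite -[u]reprK (stable_scaleE b) !stable_scaleE scalerA. Qed.
Fact stable_scale1 : left_id 1 stable_scale.
Proof. by move=> u; rewrite -[u]reprK stable_scaleE scale1r. Qed.
Fact stable_scaleDr : right_distributive stable_scale +%R.
Proof.
by move=> a u v; rewrite -[u]reprK -[v]reprK !stable_scaleE !stable_addE stable_scaleE scalerDr.
Qed.
Fact stable_scaleDl u : {morph stable_scale^~ u : a b / a + b}.
Proof. by move=> a b; rewrite -[u]reprK !stable_scaleE stable_addE scalerDl. Qed.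
HB.instance Definition _ := GRing.Zmodule_isLmodule.Build k (stable_hom X Y)
  stable_scaleA stable_scale1 stable_scaleDr stable_scaleDl.

Lemma stable_ZE a (f : Mor X Y) :
  a *: \pi_(stable_hom X Y) f = \pi_(stable_hom X Y) (a *: f).
Proof. exact: stable_scaleE. Qed.
End StableModule.

Definition stable_id X : stable_hom X X := \pi_(stable_hom X X) (idm X).
Definition stable_comp X Y Z (v : stable_hom Y Z) (u : stable_hom X Y) : stable_hom X Z :=
  \pi_(stable_hom X Z) (repr v \oc repr u).

Lemma stable_compE X Y Z (g : Mor Y Z) (f : Mor X Y) :
  stable_comp (\pi_(stable_hom Y Z) g) (\pi_(stable_hom X Y) f) =
  \pi_(stable_hom X Z) (g \oc f).
Proof.
apply/stable_eqP; set g' := repr _; set f' := repr _.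
have -> : g' \oc f' - g \oc f = (g' - g) \oc f' + g \oc (f' - f).
  by rewrite compBl compBr addrA subrK.
by rewrite rpredD //; [apply: ptriv_compr|apply: ptriv_compl]; exact: stable_repr.
Qed.

Fact stable_comp1m X Y (u : stable_hom X Y) : stable_comp (stable_id Y) u = u.
Proof. by rewrite -[u]reprK stable_compE comp1m. Qed.
Fact stable_compm1 X Y (u : stable_hom X Y) : stable_comp u (stable_id X) = u.
Proof. by rewrite -[u]reprK stable_compE compm1. Qed.
Fact stable_compA W X Y Z (w : stable_hom Y Z) (v : stable_hom X Y) (u : stable_hom W X) :
  stable_comp w (stable_comp v u) = stable_comp (stable_comp w v) u.
Proof.
elim/quotW: u => f; elim/quotW: v => g; elim/quotW: w => h.
by rewrite (stable_compE g f) (stable_compE h g) !stable_compE compA. Qed.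
Fact stable_comp_linear_r X Y Z (v : stable_hom Y Z) :
  linear (fun u : stable_hom X Y => stable_comp v u).
Proof.
move=> a; elim/quotW: v => g; elim/quotW=> f; elim/quotW=> f'.
by rewrite stable_ZE stable_addE (stable_compE g f) (stable_compE g f') stable_compE
  stable_ZE stable_addE compDr compZr.
Qed.
Fact stable_comp_linear_l X Y Z (u : stable_hom X Y) :
  linear (fun v : stable_hom Y Z => stable_comp v u).
Proof.
move=> a; elim/quotW: u => f; elim/quotW=> g; elim/quotW=> g'.
by rewrite stable_ZE stable_addE (stable_compE g f) (stable_compE g' f) stable_compE
  stable_ZE stable_addE compDl compZl.
Qed.

Definition stable : linCat k :=
  @LinCat k C stable_hom stable_id stable_comp stable_comp1m stable_compm1
    stable_compA stable_comp_linear_r stable_comp_linear_l.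

Lemma pull_stable X Y Z (f g : Mor X Y) (x : Ext1 Y Z) :
  \pi_(stable_hom X Y) f = \pi_(stable_hom X Y) g -> pull f x = pull g x.
Proof.
move=> /stable_eqP/ptrivP/(_ Z x) fg0.
by rewrite -[f](subrK g) pull_add fg0 add0r.
Qed.

Section DExt.
Variables (J : lmodType k) (X : C).

Definition DExt_ob (W : stable) : lmodType k := dual J (Ext1 W X).
Definition DExt_map (W W' : stable) (u : Mor W W') : {linear DExt_ob W -> DExt_ob W'} :=
  @dual_map k J _ _ (@pull X W' W (repr (u : stable_hom W W'))).

Fact DExt_map1 (W : stable) (phi : DExt_ob W) : DExt_map (idm W) phi = phi.
Proof.
apply: linear_map_ext => x /=; congr (phi _); rewrite -[RHS]pull1.
by apply: pull_stable; rewrite reprK.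
Qed.

Fact DExt_mapM (W1 W2 W3 : stable) (v : Mor W2 W3) (u : Mor W1 W2) (phi : DExt_ob W1) :
  DExt_map (v \oc u) phi = DExt_map v (DExt_map u phi).
Proof.
apply: linear_map_ext => x /=; congr (phi _); rewrite -pullM.
by apply: pull_stable; rewrite reprK.
Qed.

Definition DExt : modFunctor stable := ModFunctor DExt_map1 DExt_mapM.
End DExt.

(* Membership in the subcategory C_l. *)
Definition in_Cl (J : lmodType k) (X : C) : Prop := representable (DExt J X).
End Ext.

(* Main.v *)
(* Let x in Ext(Y,K) be the conflation given by the right minimal version of
   the deflation. A map g to Y factors through the deflation iff g^* x = 0, and
   a pushout argument shows that the deflation is right Z-determined iff Z
   detects K: every nonzero element of Ext(T,K) stays nonzero under some h^*
   with h : Z -> T. If D Ext(-,K) is representable, the representing object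
   detects K because the injective cogenerator J of k cogenerates. Conversely,
   suppose that Z detects a local K. A minimal nonzero End(Z)-submodule of
   Ext(Z,K) yields, over a local summand Z' of Z, an almost split conflation z
   starting at K; choosing a linear form gamma with gamma z <> 0, the pairing
   (f, y) |-> gamma (f^* y) between stable maps Z' -> T and Ext(T,K) is
   nondegenerate on both sides. Since k is artinian and J is minimal, every
   endomorphism of J is a scalar, so finitely generated k-modules are reflexive
   and Z' represents D Ext(-,K). Direct sums give the general case. *)
From HB Require Import structures.
From mathcomp Require Import all_boot all_order all_algebra.
From mathcomp Require Import generic_quotient ring_quotient boolp classical_sets.
Require Import Defs.

Set Implicit Arguments.
Unset Strict Implicit.
Unset Printing Implicit Defensive.

Import GRing.Theory.
Local Open Scope ring_scope.
Local Open Scope quotient_scope.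

(** * Modules over an artinian ring *)

Section Submodules.
Variable k : comPzRingType.
Implicit Types U V M : lmodType k.

Definition submodule V (N : V -> Prop) : Prop :=
  N 0 /\ forall a x y, N x -> N y -> N (a *: x + y).

Lemma submodule0 V (N : V -> Prop) : submodule N -> N 0.
Proof. by case. Qed.

Lemma submoduleD V (N : V -> Prop) x y : submodule N -> N x -> N y -> N (x + y).
Proof. by move=> [_ NZD] Nx Ny; rewrite -[x]scale1r; apply: NZD. Qed.

Lemma submoduleZ V (N : V -> Prop) a x : submodule N -> N x -> N (a *: x).
Proof. by move=> [N0 NZD] Nx; rewrite -[_ *: _]addr0; apply: NZD. Qed.

Lemma submoduleN V (N : V -> Prop) x : submodule N -> N x -> N (- x).
Proof. by move=> subN Nx; rewrite -scaleN1r; apply: submoduleZ. Qed.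

Lemma submoduleB V (N : V -> Prop) x y : submodule N -> N x -> N y -> N (x - y).
Proof. by move=> subN Nx Ny; apply: submoduleD => //; apply: submoduleN. Qed.

(** The proof is a parameter so that the closure instance below can be attached to
    [sub_pred subN]. *)
Definition sub_pred V (N : V -> Prop) (_ : submodule N) : {pred V} :=
  fun x => `[< N x >].

Fact sub_pred_submod V (N : V -> Prop) (subN : submodule N) :
  submod_closed (sub_pred subN).
Proof.
split=> [|a x y /asboolP Nx /asboolP Ny]; apply/asboolP; first exact: submodule0.
exact: subN.2.
Qed.
HB.instance Definition _ V (N : V -> Prop) (subN : submodule N) :=
  GRing.isSubmodClosed.Build k V (sub_pred subN) (sub_pred_submod subN).

Record sub_module V (N : V -> Prop) (subN : submodule N) :=
  SubModule { sub_val :> V; sub_valP : sub_val \in sub_pred subN }.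
HB.instance Definition _ V (N : V -> Prop) (subN : submodule N) :=
  [isSub for @sub_val V N subN].
HB.instance Definition _ V (N : V -> Prop) (subN : submodule N) :=
  [Choice of sub_module subN by <:].
HB.instance Definition _ V (N : V -> Prop) (subN : submodule N) :=
  [SubChoice_isSubLmodule of sub_module subN by <:].

Lemma sub_moduleP V (N : V -> Prop) (subN : submodule N) (x : sub_module subN) :
  N (sub_val x).
Proof. by apply/asboolP; case: x. Qed.

Section Quotient.
Variables (V : lmodType k) (N : V -> Prop) (subN : submodule N).

Definition quot_module := Quotient.quot (sub_pred subN).
HB.instance Definition _ := GRing.Zmodule.on quot_module.
HB.instance Definition _ := ZmodQuotient.on quot_module.

Lemma quot_eqP (x y : V) :
  reflect (\pi_quot_module x = \pi_quot_module y) (x - y \in sub_pred subN).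
Proof. by rewrite Quotient.idealrBE; exact: eqP. Qed.

Definition quot_scale a (u : quot_module) : quot_module :=
  \pi_quot_module (a *: repr u).

Lemma quot_scaleE a (x : V) :
  quot_scale a (\pi_quot_module x) = \pi_quot_module (a *: x).
Proof.
by apply/quot_eqP; rewrite -scalerBr rpredZ //; apply/quot_eqP; rewrite reprK.
Qed.

Fact quot_scaleA a b u : quot_scale a (quot_scale b u) = quot_scale (a * b) u.
Proof. by rewrite -[u]reprK (quot_scaleE b) !quot_scaleE scalerA. Qed.
Fact quot_scale1 : left_id 1 quot_scale.
Proof. by move=> u; rewrite -[u]reprK quot_scaleE scale1r. Qed.
Fact quot_scaleDr : right_distributive quot_scale +%R.
Proof.
move=> a u v; rewrite -[u]reprK -[v]reprK !quot_scaleE.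
by rewrite -raddfD quot_scaleE scalerDr raddfD.
Qed.
Fact quot_scaleDl u : {morph quot_scale^~ u : a b / a + b}.
Proof. by move=> a b; rewrite -[u]reprK !quot_scaleE scalerDl raddfD. Qed.
HB.instance Definition _ := GRing.Zmodule_isLmodule.Build k quot_module
  quot_scaleA quot_scale1 quot_scaleDr quot_scaleDl.

Definition quot_pi (x : V) : quot_module := \pi_quot_module x.
Fact quot_pi_linear : linear quot_pi.
Proof. by move=> a x y; rewrite /quot_pi raddfD; congr (_ + _); exact/esym/quot_scaleE. Qed.
HB.instance Definition _ :=
  GRing.isLinear.Build k V quot_module _ quot_pi quot_pi_linear.

Lemma quot_pi_eq0 x : quot_pi x = 0 <-> N x.
Proof.
rewrite -[0](raddf0 quot_pi); split=> [/quot_eqP|Nx]; last first.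
  by apply/quot_eqP; rewrite subr0; apply/asboolP.
by rewrite subr0 => /asboolP.
Qed.
End Quotient.

Lemma maximal_submodule V (Q : V -> Prop) : Q 0 ->
  exists N, [/\ submodule N, forall x, N x -> Q x &
    forall N', submodule N' -> (forall x, N' x -> Q x) ->
      (forall x, N x -> N' x) -> forall x, N' x -> N x].
Proof.
move=> Q0.
(* Membership of 0 is left out of [P] so that the union of an empty chain qualifies; a maximal [N]
   is nonempty by comparison with the zero submodule. *)
pose P (N : V -> Prop) :=
  (forall x, N x -> Q x) /\ forall a x y, N x -> N y -> N (a *: x + y).
have [F FP totF|N [[NQ NZD] maxN]] := @Zorn_bigcup V P.
  split=> [x [N FN Nx]|a x y [N FN Nx] [N' FN' N'y]]; first exact: (FP _ FN).1.
  have [NN'|N'N] := totF _ _ FN FN'.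
    by exists N' => //; apply: (FP _ FN').2 => //; apply: NN'.
  by exists N => //; apply: (FP _ FN).2 => //; apply: N'N.
have max N' : submodule N' -> (forall x, N' x -> Q x) ->
    (forall x, N x -> N' x) -> forall x, N' x -> N x.
  move=> subN' N'Q NN' x N'x; apply: contrapT => Nx.
  apply: (maxN N'); last by split=> //; exact: subN'.2.
  by split=> // /(_ x N'x).
exists N; split=> //; split=> //; apply: contrapT => N0.
have N_empty x : ~ N x.
  by move=> Nx; apply: N0; rewrite -(addNr x) -scaleN1r; apply: NZD.
apply: N0; apply: (max (fun x => x = 0)) => // [|x ->//|x /N_empty //].
by split=> // a x y -> ->; rewrite scaler0 addr0.
Qed.

(** * Descending chain conditions *)

Definition artinian V : Prop :=
  forall N : nat -> V -> Prop, (forall n, submodule (N n)) ->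
    (forall n x, N n.+1 x -> N n x) ->
    exists m, forall n, (m <= n)%N -> forall x, N m x -> N n x.

Lemma artinian_self : artinian_ring k -> artinian k^o.
Proof.
move=> artk N subN decN.
have [|n x /asboolP Nx|m Nm] := artk (fun n => sub_pred (subN n)).
- by move=> n; exact: sub_pred_submod.
- by apply/asboolP/decN.
exists m => n mn x Nx.
suff /asboolP : x \in sub_pred (subN n) by [].
by rewrite Nm //; apply/asboolP.
Qed.

Lemma decreasing_le V (N : nat -> V -> Prop) : (forall n x, N n.+1 x -> N n x) ->
  forall m n, (m <= n)%N -> forall x, N n x -> N m x.
Proof.
move=> decN m n /subnK <-; elim: (n - m)%N => [|d IHd] x; first by rewrite add0n.
by rewrite addSn => /decN/IHd.
Qed.

(** Without a minimal member, iterated choice from [i0] gives a strictly descending chain. The index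
    type lets scalars, morphisms or lists name the submodules. *)
Lemma artinian_minimal V (I : Type) (Q : I -> Prop) (N : I -> V -> Prop) (i0 : I) :
  artinian V -> (forall i, submodule (N i)) -> Q i0 ->
  exists i, Q i /\
    forall j, Q j -> (forall x, N j x -> N i x) -> forall x, N i x -> N j x.
Proof.
move=> artV subN Qi0; apply: contrapT => no_min.
have step (i : {i | Q i}) : exists j : {i | Q i},
    (forall x, N (sval j) x -> N (sval i) x) /\ exists x, N (sval i) x /\ ~ N (sval j) x.
  case: i => i Qi /=; apply: contrapT => no_j; apply: no_min; exists i; split=> //.
  move=> j Qj Nji x Nix; apply: contrapT => Njx; apply: no_j.
  by exists (exist _ j Qj); split=> //; exists x.
have [f fP] := choice step.
pose s n := iter n f (exist _ i0 Qi0).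
have [n x /(fP (s n)).1 //|m Nm] := artV (fun n => N (sval (s n))) (fun n => subN _).
by have [_ [x [Nx]]] := fP (s m); apply; exact: Nm (leqnSn m) _ Nx.
Qed.

Lemma fg_artinian V : artinian_ring k -> finitely_generated V -> artinian V.
Proof.
move=> /artinian_self artk [n [e genV]] N subN decN.
have N_le := decreasing_le decN.
suff {genV} [m Nm] : exists m, forall n', (m <= n')%N -> forall c : 'I_n -> k,
    N m (\sum_i c i *: e i) -> N n' (\sum_i c i *: e i).
  by exists m => n' mn' x; have [c ->] := genV x; exact: Nm.
elim: n e => [|n IHn] e.
  by exists 0%N => n' _ c _; rewrite big_ord0; exact: submodule0.
have [m1 Nm1] := IHn (fun i => e (lift ord0 i)).
(* The ideal of coefficients at the first generator of elements of [N m]; these ideals become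
   stationary because [k] is artinian. *)
pose I m (a : k^o) := exists c : 'I_n -> k,
  N m (a *: e ord0 + \sum_i c i *: e (lift ord0 i)).
have subI m : submodule (I m).
  split=> [|a x y [c Nc] [d Nd]].
    exists (fun=> 0); rewrite scale0r add0r big1 => [|i _]; last exact: scale0r.
    exact: submodule0.
  exists (fun i => a * c i + d i).
  have := (subN m).2 a _ _ Nc Nd; congr N.
  rewrite scalerDr scalerA addrACA -scalerDl; congr (_ + _).
  rewrite scaler_sumr -big_split; apply: eq_bigr => i _ /=.
  by rewrite scalerDl scalerA.
have [m2 Im2] : exists m, forall n, (m <= n)%N -> forall x, I m x -> I n x.
  by apply: artk => // m a [c /decN Nc]; exists c.
exists (maxn m1 m2) => n' mn' c.
move: mn'; rewrite geq_max => /andP[m1n' m2n'].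
rewrite big_ord_recl => Nc.
have [d Nd] : I n' (c ord0).
  by apply: (Im2 _ m2n'); exists (fun i => c (lift ord0 i)); exact: N_le (leq_maxr _ _) _ Nc.
(* The two elements share their first coefficient, so the difference lies in the span of the other
   generators, where [IHn] applies. *)
have Nn' : N n' (\sum_i (c (lift ord0 i) - d i) *: e (lift ord0 i)).
  apply: Nm1 => //; under eq_bigr do rewrite scalerBl.
  rewrite sumrB; set u := \sum_i _ in Nc *; set v := \sum_i _ in Nd *.
  rewrite -[u](addKr (c ord0 *: e ord0)) addrC addrA -opprD addrC (addrC v).
  apply: submoduleB => //; first exact: N_le (leq_maxl _ _) _ Nc.
  exact: N_le m1n' _ Nd.
move: Nn'; under eq_bigr do rewrite scalerBl.
rewrite sumrB; set u := \sum_i _ in Nc *; set v := \sum_i _ in Nd *.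
by move=> /(submoduleD (subN n') Nd); rewrite -addrA subrKC.
Qed.

(* An ideal [m] is maximal when the quotient by it is a field. *)
Definition maximal_ideal (m : k^o -> Prop) : Prop :=
  [/\ submodule m, ~ m 1 & forall b, ~ m b -> exists c : k, m (1 - c * b)].

(** Take the ideal [k a] minimal among those with [a *: x] outside [N]. If [b *: (a *: x)] is also
    outside, then [a = c * (b * a)] for some [c], and [1 - c * b] sends [a *: x] into [N]. *)
Lemma exists_maximal_annihilator V (N : V -> Prop) x :
  artinian_ring k -> submodule N -> ~ N x ->
  exists a, ~ N (a *: x) /\ maximal_ideal (fun b => N (b *: (a *: x))).
Proof.
move=> /artinian_self artk subN Nx.
have [||a [Nax min_a]] := @artinian_minimal k^o k (fun a => ~ N (a *: x))
  (fun a c => exists b : k, c = b * a) 1 artk.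
- move=> a; split=> [|d _ _ [b ->] [c ->]]; first by exists 0; rewrite mul0r.
  by exists (d * b + c); rewrite mulrDl; congr (_ + _); exact: mulrA.
- by rewrite scale1r.
exists a; split=> //; split.
- split=> [|d b c Nb Nc]; first by rewrite scale0r; exact: submodule0.
  by rewrite scalerDl -scalerA; exact: subN.2.
- by rewrite scale1r.
- move=> b Nba.
  have [|c [d ->]||c ac] := min_a (b * a) _ _ a.
  + by rewrite -scalerA.
  + by exists (d * b); exact: mulrA.
  + by exists 1; rewrite mul1r.
  exists c; rewrite scalerA mulrBl mul1r -mulrA -ac subrr scale0r.
  exact: submodule0.
Qed.
End Submodules.
(** * Endomorphisms of the minimal injective cogenerator *)

Section InjectiveCogenerator.
Variables (k : comPzRingType) (J : lmodType k).
Hypothesis artk : artinian_ring k.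
Implicit Types U V M : lmodType k.

Lemma scaler_swap V a b (x : V) : a *: (b *: x) = b *: (a *: x).
Proof. by rewrite !scalerA mulrC. Qed.

(** The last hypothesis makes [G] the graph of a linear map on a submodule of [V], which injectivity
    extends. Partial linear maps are given by their graphs throughout. *)
Lemma extend_graph V (G : V * J -> Prop) :
  injective_module J -> submodule G -> (forall y, G (0, y) -> y = 0) ->
  exists h : {linear V -> J}, forall v y, G (v, y) -> h v = y.
Proof.
move=> injJ subG G0.
pose m : {linear sub_module subG -> V} := fst \o val.
pose f : {linear sub_module subG -> J} := snd \o val.
have m_ker u : m u = 0 -> u = 0.
  case: u => [[u1 u2] Gu] /= u10; have Gu12 := sub_moduleP (SubModule Gu).
  apply: (@val_inj _ _ (sub_module subG)) => /=; move: Gu12 => /=.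
  by rewrite u10 => /G0 ->.
have m_inj : injective m.
  move=> u v muv; apply/subr0_eq/m_ker; apply: (etrans (raddfB m u v)).
  by apply/eqP; rewrite subr_eq0; apply/eqP.
have [h hP] := injJ _ _ m f m_inj.
exists h => v y Gvy.
have GP : (v, y) \in sub_pred subG by apply/asboolP.
exact: (hP (SubModule GP)).
Qed.

Lemma separate V (N : V -> Prop) x : cogenerator J -> submodule N -> ~ N x ->
  exists h : {linear V -> J}, (forall y, N y -> h y = 0) /\ h x <> 0.
Proof.
move=> cogJ subN Nx.
have [|h hx] := cogJ (quot_module subN) (quot_pi subN x).
  by apply/eqP => /quot_pi_eq0.
exists (h \o quot_pi subN); split=> [y /quot_pi_eq0 y0|/eqP /=].
  by rewrite /= y0 raddf0.
exact/negP.
Qed.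

(** * An injective envelope of a multiplicity-free socle *)

Section Envelope.
Hypotheses (injJ : injective_module J) (cogJ : cogenerator J).

Definition killed_by (m : k^o -> Prop) V (x : V) : Prop := forall b, m b -> b *: x = 0.

(** Some linear form from [k] to [J] vanishes on [m] but not at 1; its value at 1 is [soc m]. *)
Lemma exists_socle_generator : exists soc : (k^o -> Prop) -> J, forall m,
  maximal_ideal m -> soc m <> 0 /\ killed_by m (soc m).
Proof.
suff /choice[soc socP] : forall m : k^o -> Prop, exists x : J,
  maximal_ideal m -> x <> 0 /\ killed_by m x by exists soc.
move=> m; have [|not_max] := pselect (maximal_ideal m); last by exists 0 => /not_max.
move=> [subm m1 maxm]; have [h [hm h1]] := separate cogJ subm m1.
exists (h 1) => _; split=> // b /hm hb.
by rewrite -linearZ /=; have -> : b *: (1 : k^o) = b by exact: mulr1.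
Qed.

Lemma killed_by_maximal_inj V m m' (x : V) :
  maximal_ideal m -> maximal_ideal m' -> x <> 0 -> killed_by m x -> killed_by m' x -> m = m'.
Proof.
have incl n n' : maximal_ideal n -> maximal_ideal n' -> x <> 0 ->
    killed_by n x -> killed_by n' x -> forall b, n b -> n' b.
  move=> [subn n1 maxn] [subn' n'1 maxn'] x0 nx n'x b nb; apply: contrapT => n'b.
  have [c /n'x] := maxn' b n'b.
  by rewrite scalerBl scale1r -scalerA nx // scaler0 subr0.
move=> maxm maxm' x0 mx m'x; apply/funext => b; apply/propext; split.
  exact: (incl m m').
exact: (incl m' m).
Qed.

(* [E] is an injective envelope, inside [J], of the submodule generated by the
   [soc m]; its [m]-torsion is the simple module [k soc m]. *)
Lemma multiplicity_free_summand : exists (E : J -> Prop) (soc : (k^o -> Prop) -> J),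
  [/\ submodule E,
      exists p : {linear J -> J}, (forall y, E (p y)) /\ forall y, E y -> p y = y,
      forall m, maximal_ideal m -> [/\ soc m <> 0, killed_by m (soc m) & E (soc m)] &
      forall y, E y -> y <> 0 -> exists (a : k) m, maximal_ideal m /\ a *: y = soc m].
Proof.
have [soc socP] := exists_socle_generator.
pose gen y := exists2 m, maximal_ideal m & y = soc m.
have gen0 y : gen y -> y <> 0 by move=> [m /socP[sm0 _] ->].
(* [C] is maximal among the submodules containing no [soc m], and [E] below among those whose
   nonzero elements all have some [soc m] as a multiple. Hence [E] and [C] meet in 0. *)
have [|C [subC Cgen maxC]] := @maximal_submodule k J (fun y => ~ gen y).
  by move=> /gen0.
have [//|E [subE Egen maxE]] :=
  @maximal_submodule k J (fun y => y <> 0 -> exists a : k, gen (a *: y)).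
have Esoc m : maximal_ideal m -> E (soc m).
  move=> maxm; have [sm0 msm] := socP m maxm; have [subm m1 invm] := maxm.
  apply: (maxE (fun y => exists a : k, E (y - a *: soc m))).
  - split=> [|a y y' [b Eb] [b' Eb']]; first by exists 0; rewrite scale0r subr0; exact: submodule0.
    exists (a * b + b'); have := subE.2 a _ _ Eb Eb'; congr E.
    by rewrite scalerBr scalerA scalerDl opprD addrACA.
  - move=> y [a Ey] y0; have [ma|] := pselect (m a).
      by apply: Egen => //; rewrite -[y]subr0 -(msm a ma).
    move=> /invm[c mca]; set e := y - _ in Ey.
    have sE u v : m (1 - u * v) -> u *: (v *: soc m) = soc m.
      by move=> /msm/eqP; rewrite scalerBl scale1r subr_eq0 scalerA => /eqP.
    have yE : y = e + a *: soc m by rewrite subrK.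
    (* If some [b] outside [m] kills [e], then [b *: y] is a nonzero multiple of [soc m]. If some
       [b] in [m] does not, then [b *: y = b *: e] lies in [E]. Otherwise [e] has annihilator [m],
       and its multiple in the socle is [soc m] itself. *)
    have [[b [be0 /invm[c' mcb]]]|ann_e] := pselect (exists b, b *: e = 0 /\ ~ m b).
      exists (c * (c' * b)); exists m => //.
      rewrite -2!scalerA yE [b *: _]scalerDr be0 add0r.
      by rewrite (scaler_swap b) (scaler_swap c') sE // sE.
    have [[b [mb be0]]|ann_e'] := pselect (exists b, m b /\ b *: e <> 0).
      have [d [m' maxm' dm']] := Egen _ (submoduleZ b subE Ey) be0.
      exists (d * b); exists m' => //.
      by rewrite -dm' -scalerA yE [b *: _]scalerDr (scaler_swap b) msm // scaler0 addr0.
    have me : killed_by m e.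
      by move=> b mb; apply: contrapT => be; apply: ann_e'; exists b.
    have e0 : e <> 0.
      by move=> e0; apply: ann_e; exists 1; rewrite e0 scaler0.
    have [d [m' maxm' dm']] := Egen _ Ey e0.
    have [sm'0 m'sm'] := socP m' maxm'.
    have mm' : m = m'.
      apply: (killed_by_maximal_inj maxm maxm' sm'0) => // b mb.
      by rewrite -dm' scaler_swap me // scaler0.
    apply: Egen => //; rewrite yE; apply: submoduleD => //.
    by apply: submoduleZ => //; rewrite mm' -dm'; exact: submoduleZ.
  - by move=> y Ey; exists 0; rewrite scale0r subr0.
  - by exists 1; rewrite scale1r subrr; exact: submodule0.
(* [p] extends the projection of the direct sum of [E] and [C] onto [E]. *)
have [||p pP] := @extend_graph J (fun v => E v.2 /\ C (v.1 - v.2)) injJ.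
- split=> [|a [x y] [x' y'] /= [Ey Cxy] [Ey' Cxy']].
    by split; rewrite /= ?subr0; exact: submodule0.
  split; first exact: subE.2.
  have := subC.2 a _ _ Cxy Cxy'; congr C.
  by rewrite scalerBr opprD addrACA.
- move=> y /= [Ey]; rewrite sub0r => Cy; apply: contrapT => y0.
  have [a gay] := Egen _ Ey y0; apply: (Cgen (a *: y)) => //.
  by apply: submoduleZ => //; rewrite -[y]opprK; exact: submoduleN.
have pE y : E y -> p y = y by move=> Ey; apply: pP; rewrite subrr; split=> //; exact: submodule0.
have pC y : C y -> p y = 0 by move=> Cy; apply: pP; rewrite subr0; split=> //; exact: submodule0.
exists E, soc; split=> //; last first.
- by move=> y Ey /(Egen _ Ey)[a [m maxm ay]]; exists a, m.
- by move=> m maxm; have [? ?] := socP m maxm; split=> //; exact: Esoc.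
exists p; split=> // y.
(* The image of [p] contains [E], so by maximality it suffices that its nonzero elements have socle
   multiples; if [p z] had none, [C] could be enlarged by [z]. *)
apply: (maxE (fun z => exists y, z = p y)); last by exists y.
- split=> [|a _ _ [x ->] [x' ->]]; first by exists 0; rewrite raddf0.
  by exists (a *: x + x'); rewrite linearP.
- move=> _ [z ->] pz0; apply: contrapT => no_gen; apply: pz0; apply: (pC z).
  apply: (maxC (fun y => exists a : k, C (y - a *: z))).
  + split=> [|a x x' [b Cb] [b' Cb']]; first by exists 0; rewrite scale0r subr0; exact: submodule0.
    exists (a * b + b'); have := subC.2 a _ _ Cb Cb'; congr C.
    by rewrite scalerBr scalerA scalerDl opprD addrACA.
  + move=> x [a Ca] [m maxm xm]; apply: no_gen; exists a; exists m => //.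
    rewrite -[RHS](pE _ (Esoc _ maxm)) -linearZ -xm /=; apply/esym/eqP.
    by rewrite -subr_eq0 -raddfB /= (pC _ Ca).
  + by move=> x Cx; exists 0; rewrite scale0r subr0.
  + by exists 1; rewrite scale1r subrr; exact: submodule0.
- by move=> x Ex; exists x; rewrite pE.
Qed.
End Envelope.

(** The summand [E] is itself an injective cogenerator, so minimality embeds [J] in it. There,
    nonzero elements killed by [m] have [soc m] as a common multiple. *)
Lemma simple_torsion m (x y : J) : minimal_injective_cogenerator J ->
  maximal_ideal m -> x <> 0 -> killed_by m x -> killed_by m y -> exists c : k, y = c *: x.
Proof.
move=> [injJ cogJ minJ] maxm x0 mx my.
have [E [soc [subE [p [pE pid]] socP Egen]]] := multiplicity_free_summand injJ cogJ.
pose J' := sub_module subE.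
have q_subproof z : p z \in sub_pred subE by apply/asboolP.
pose q z : J' := SubModule (q_subproof z).
have q_lin : linear q.
  by move=> a u v; apply/val_inj; rewrite /= linearP.
pose qL := GRing.isLinear.Build k J J' _ q q_lin.
pose Q : {linear J -> J'} := HB.pack q qL.
have injJ' : injective_module J'.
  move=> U V i f i_inj; have [h hP] := injJ _ _ i (val \o f : {linear U -> J}) i_inj.
  exists (Q \o h : {linear V -> J'}) => u /=; apply/val_inj.
  by rewrite /= hP /= pid //; exact: sub_moduleP.
(* A multiple [a *: v] has a maximal annihilator; it can be sent to the corresponding socle
   generator, and the map extends to [M]. *)
have cogJ' : cogenerator J'.
  move=> M v /eqP v0.
  have [||a [av0 max_a]] := @exists_maximal_annihilator k M (fun u => u = 0) v artk.
  - by split=> // a u w -> ->; rewrite scaler0 addr0.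
  - by [].
  have [s0 ms Es] := socP _ max_a; set s := soc _ in s0 ms Es.
  have [||h hP] := @extend_graph M
    (fun u => exists b : k, u.1 = b *: (a *: v) /\ u.2 = b *: s) injJ.
  - split=> [|d [u1 u2] [w1 w2] /= [b [-> ->]] [c [-> ->]]]; first by exists 0; rewrite !scale0r.
    by exists (d * b + c); rewrite !scalerDl -!scalerA.
  - by move=> z /= [b [/esym/ms + ->]].
  have hav : h (a *: v) = s by apply: hP; exists 1; rewrite !scale1r.
  exists (Q \o h : {linear M -> J'}); apply/eqP => /= /(congr1 val) /= phv.
  by apply: s0; rewrite -(pid _ Es) -hav linearZ linearZ /= phv scaler0.
have [mu mu_inj] := minJ J' injJ' cogJ'.
have [->|y0] := pselect (y = 0); first by exists 0; rewrite scale0r.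
have mu_gen z : z <> 0 -> killed_by m z ->
    exists a : k, a *: mu z <> 0 /\ sub_val (a *: mu z) = soc m.
  move=> z0 mz; have Ez := sub_moduleP (mu z).
  have [|a [m' [maxm' am']]] := Egen _ Ez.
    by move=> muz0; apply/z0/mu_inj/val_inj; rewrite raddf0.
  have [s0 ms _] := socP _ maxm'; have mm' : m = m'.
    apply: (killed_by_maximal_inj maxm maxm' s0) => // b mb.
    rewrite -am' scaler_swap.
    have -> : b *: sub_val (mu z) = 0; last exact: scaler0.
    have -> : b *: sub_val (mu z) = val (mu (b *: z)) by rewrite linearZ.
    by rewrite mz // raddf0.
  exists a; rewrite mm'; split=> // amuz; apply: s0.
  by rewrite -am' -[a *: _]/(sub_val (a *: mu z)) amuz.
have [a [_ asm]] := mu_gen x x0 mx.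
have [b [bmy0 bsm]] := mu_gen y y0 my.
have [_ _ /(_ b)[|c mcb]] := maxm.
  by move=> /my by0; apply: bmy0; rewrite -linearZ /= by0 raddf0.
exists (c * a); apply: mu_inj.
have -> : y = (c * b) *: y.
  by apply/eqP; rewrite -subr_eq0 -[y in y - _]scale1r -scalerBl my.
rewrite -!scalerA !linearZ /=; congr (c *: _); apply/val_inj.
by rewrite -[LHS]/(sub_val _) -[RHS]/(sub_val _) asm.
Qed.

(** * Endomorphisms of [J] are scalars *)

Section Endomorphisms.
Hypothesis minJ : minimal_injective_cogenerator J.
Let injJ : injective_module J. Proof. by case: minJ. Qed.
Let cogJ : cogenerator J. Proof. by case: minJ. Qed.

Lemma linear_ffun_components n (th : {linear {ffun 'I_n -> J} -> J}) :
  exists g : 'I_n -> {linear J -> J}, forall u, th u = \sum_i g i (u i).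
Proof.
pose delta i (y : J) : {ffun 'I_n -> J} := [ffun j => if j == i then y else 0].
have delta_lin i : linear (delta i).
  move=> a x y; apply/ffunP => j; rewrite !ffunE.
  by case: eqP => // _; rewrite scaler0 addr0.
pose deltaL i : {linear J -> {ffun 'I_n -> J}} :=
  HB.pack (delta i) (GRing.isLinear.Build _ _ _ _ _ (delta_lin i)).
exists (fun i => th \o deltaL i : {linear J -> J}) => u.
have {1}-> : u = \sum_i delta i (u i).
  apply/ffunP => j; rewrite sum_ffunE (bigD1 j) //= big1 ?addr0; last first.
    by move=> i ij; rewrite ffunE eq_sym (negPf ij).
  by rewrite ffunE eqxx.
by rewrite raddf_sum.
Qed.

(* If [h F] were not a multiple of [F] in [J^n], a linear form [theta] on
   [J^n] would separate them; its components commute with [h] on [F]. *)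
Lemma commuting_scalar_seq (N : J -> Prop) (h : {linear J -> J}) (F : seq J) :
  (forall (g : {linear J -> J}) x, N x -> g (h x) = h (g x)) ->
  (forall x, x \in F -> N x) -> exists c : k, forall x, x \in F -> h x = c *: x.
Proof.
move=> comm FN; pose n := size F.
pose v : {ffun 'I_n -> J} := [ffun i => F`_(val i)].
have Fv x : x \in F -> exists i : 'I_n, x = v i.
  by move=> /(nthP 0)[i ltin <-]; exists (Ordinal ltin); rewrite ffunE.
pose hv : {ffun 'I_n -> J} := [ffun i => h (v i)].
have [[c hvc]|no_c] := pselect (exists c, hv = c *: v).
  exists c => x /Fv[i ->]; have /ffunP/(_ i) := hvc.
  by rewrite /hv ffunE => ->; rewrite ffunE.
have [||th [thv]] := @separate {ffun 'I_n -> J} (fun u => exists c, u = c *: v) hv cogJ.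
- split=> [|d _ _ [b ->] [c ->]]; first by exists 0; rewrite scale0r.
  by exists (d * b + c); rewrite scalerDl scalerA.
- by [].
case; have [g thE] := linear_ffun_components th.
have -> : th hv = h (th v).
  rewrite !thE raddf_sum; apply: eq_bigr => i _; rewrite [hv i]ffunE comm //.
  by apply: FN; rewrite ffunE mem_nth // ltn_ord.
by rewrite thv ?raddf0 //; exists 1; rewrite scale1r.
Qed.

(** Choose a finite [F] in [N] with minimal annihilator. Adjoining [y] does not shrink the
    annihilator, so two scalars that agree on [F] agree on [y]. *)
Lemma commuting_scalar (N : J -> Prop) (h : {linear J -> J}) :
  (forall (g : {linear J -> J}) x, N x -> g (h x) = h (g x)) ->
  exists c : k, forall x, N x -> h x = c *: x.
Proof.
move=> comm.
have [|a|F [FN minF]] := @artinian_minimal k k^o (seq J) (fun F => forall x, x \in F -> N x)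
  (fun F a => forall x, x \in F -> a *: x = 0) [::] (artinian_self artk).
- split=> [x _|a b c Fb Fc x Fx]; first exact: scale0r.
  by rewrite scalerDl -scalerA Fb // Fc // scaler0 addr0.
- by [].
have [c hF] := commuting_scalar_seq comm FN.
exists c => y Ny.
have yFN x : x \in y :: F -> N x by rewrite inE => /predU1P[->|/FN].
have [c' hyF] := commuting_scalar_seq comm yFN.
rewrite hyF ?mem_head //; apply/eqP; rewrite -subr_eq0 -scalerBl; apply/eqP.
apply: (minF _ yFN) (mem_head y F) => [a yFa x Fx|x Fx].
  by apply: yFa; rewrite inE Fx orbT.
by rewrite scalerBl -hyF ?inE ?Fx ?orbT // hF // subrr.
Qed.

(* For maximal ideals [m1, ..., mr], the elements killed by [m1 ... mr]. *)
Fixpoint tors (s : seq (k^o -> Prop)) (x : J) : Prop :=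
  if s is m :: s' then forall b, m b -> tors s' (b *: x) else x = 0.

Definition tors_ann s (a : k^o) : Prop := forall x, tors s x -> a *: x = 0.

Fixpoint all_maximal (s : seq (k^o -> Prop)) : Prop :=
  if s is m :: s' then maximal_ideal m /\ all_maximal s' else True.

Lemma submodule_tors s : submodule (tors s).
Proof.
elim: s => [|m s IHs]; first by split=> // a x y -> ->; rewrite scaler0 addr0.
split=> [b _|a x y mx my b mb] /=; first by rewrite scaler0; exact: submodule0.
by rewrite scalerDr scaler_swap; apply: IHs.2; [exact: mx|exact: my].
Qed.

Lemma tors_cons m s x : tors s x -> tors (m :: s) x.
Proof. by move=> sx b _; apply: submoduleZ => //; exact: submodule_tors. Qed.

Lemma submodule_tors_ann s : submodule (tors_ann s).
Proof.
split=> [x _|a b c sb sc x sx]; first exact: scale0r.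
by rewrite scalerDl -scalerA sb // sc // scaler0 addr0.
Qed.

(** By induction: for [b] in [m] and [a] in [tors_ann s], the product [a * b] annihilates
    [tors (m :: s)], hence [x]. *)
Lemma tors_ann_closed s x : (forall a, tors_ann s a -> a *: x = 0) -> tors s x.
Proof.
elim: s x => [|m s IHs] x sx /=.
  by rewrite -[x]scale1r; apply: sx => y ->; rewrite scaler0.
move=> b mb; apply: IHs => a sa; rewrite scalerA; apply: sx => y my.
by rewrite -scalerA sa //; exact: my.
Qed.

(** Take [s] with minimal annihilator. An element outside [tors s] would have a multiple outside
    [tors s] but in some [tors (m :: s)]; minimality and [tors_ann_closed] exclude this. *)
Lemma exists_tors_full : exists s, all_maximal s /\ forall x, tors s x.
Proof.
have [s [maxs mins]] := artinian_minimal (i0 := [::] : seq (k^o -> Prop)) (Q := all_maximal)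
  (artinian_self artk) submodule_tors_ann I.
exists s; split=> // x; apply: contrapT => sx.
have [a [sax max_a]] := exists_maximal_annihilator artk (submodule_tors s) sx.
set m := (fun b => _) in max_a.
apply: sax; apply: tors_ann_closed => b sb.
have : tors_ann (m :: s) b; last by apply.
apply: (mins (m :: s) (conj max_a maxs)) => // c ann_c y sy.
exact/ann_c/tors_cons.
Qed.

Lemma endo_comm_tors s (g h : {linear J -> J}) x :
  all_maximal s -> tors s x -> g (h x) = h (g x).
Proof.
have endo_killed m (f : {linear J -> J}) y : killed_by m y -> killed_by m (f y).
  by move=> my b mb; rewrite -linearZ /= my // raddf0.
have endo_scalar m (f : {linear J -> J}) y :
    maximal_ideal m -> killed_by m y -> exists c : k, f y = c *: y.
  move=> maxm my; have [->|y0] := pselect (y = 0).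
    by exists 0; rewrite raddf0 scaler0.
  by apply: (simple_torsion minJ maxm y0 my); exact: endo_killed.
elim: s g h x => [|m s IHs] g h x /=; first by move=> _ ->; rewrite !raddf0.
move=> [maxm maxs] msx.
have comm_m y : killed_by m y -> g (h y) = h (g y).
  move=> my; have [c gc] := endo_scalar m g y maxm my.
  have [d hd] := endo_scalar m h y maxm my.
  by rewrite hd gc !linearZ /= gc hd scaler_swap.
(* If [v] exists, [x] splits into an element of [tors s] and one killed by [m], and the maps commute
   on both. *)
have [[v [sv mv]]|sm] := pselect (exists v, tors_ann s v /\ ~ m v).
  have [_ _ /(_ v mv)[c mcv]] := maxm.
  have -> : x = (1 - c * v) *: x + (c * v) *: x by rewrite -scalerDl subrK scale1r.
  rewrite !raddfD /=; congr (_ + _); first exact/IHs/msx.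
  by apply: comm_m => b mb; rewrite scaler_swap -scalerA sv ?scaler0 //; exact: msx.
have torsm y : killed_by m y -> tors s y.
  move=> my; apply: tors_ann_closed => a sa; apply: my.
  by apply: contrapT => ma; apply: sm; exists a.
(* By induction [g] and [h] act on [tors s] as scalars [c] and [d]. Both [h x - d *: x] and
   [g x - c *: x] are killed by [m], so they lie in [tors s]; applying [g] to the first and [h] to
   the second gives the same value for both composites. *)
have [c gc] := commuting_scalar (N := tors s) (h := g) (fun f y => IHs f g y maxs).
have [d hd] := commuting_scalar (N := tors s) (h := h) (fun f y => IHs f h y maxs).
have drop (f : {linear J -> J}) e : (forall y, tors s y -> f y = e *: y) ->
    tors s (f x - e *: x).
  move=> fe; apply: torsm => b mb.
  by rewrite scalerBr scaler_swap -linearZ /= fe ?subrr //; exact: msx.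
have Eg := gc _ (drop h d hd); have Eh := hd _ (drop g c gc).
move/eqP: Eg; rewrite raddfB /= linearZ /= scalerBr subr_eq => /eqP ->.
move/eqP: Eh; rewrite raddfB /= linearZ /= scalerBr subr_eq => /eqP ->.
by rewrite [d *: (c *: x)]scaler_swap addrAC [RHS]addrAC; congr (_ + _); rewrite addrC.
Qed.

Lemma endo_scalar (h : {linear J -> J}) : exists c : k, forall x, h x = c *: x.
Proof.
have [s [maxs sJ]] := exists_tors_full.
have [c hc] := commuting_scalar (N := tors s) (h := h) (fun g x => endo_comm_tors g h maxs).
by exists c => x; exact/hc/sJ.
Qed.

(** Pairing with generators [e i] of [A] embeds [B] in a power of [J]. The form [phi] extends to
    this power, its components are scalars [c i], and the sum of the [c i *: e i] represents it. *)
Lemma pairing_represents (A B : lmodType k) (beta : A -> B -> J) :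
  finitely_generated A ->
  (forall b, linear (beta^~ b)) -> (forall a, linear (beta a)) ->
  (forall b, (forall a, beta a b = 0) -> b = 0) ->
  forall phi : {linear B -> J}, exists a, forall b, phi b = beta a b.
Proof.
move=> [n [e genA]] linA linB nondeg phi.
pose iota (b : B) : {ffun 'I_n -> J} := [ffun i => beta (e i) b].
have iota_lin : linear iota.
  by move=> a x y; apply/ffunP => i; rewrite !ffunE linB.
pose iotaL : {linear B -> {ffun 'I_n -> J}} :=
  HB.pack iota (GRing.isLinear.Build _ _ _ _ _ iota_lin).
have betaE (c : 'I_n -> k) b :
    beta (\sum_i c i *: e i) b = \sum_i c i *: beta (e i) b.
  pose betab : {linear A -> J} :=
    HB.pack (beta^~ b) (GRing.isLinear.Build _ _ _ _ _ (linA b)).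
  rewrite -[LHS]/(betab _) raddf_sum; apply: eq_bigr => i _.
  exact: (linearZ_LR betab).
have [||Phi PhiP] := @extend_graph {ffun 'I_n -> J} (fun u => exists b, u = (iota b, phi b)) injJ.
- split=> [|a _ _ [b ->] [b' ->]].
    by exists 0; rewrite [iota 0](raddf0 iotaL) raddf0.
  by exists (a *: b + b'); rewrite linearP iota_lin.
- move=> y [b [/esym b0 ->]]; suff -> : b = 0 by rewrite raddf0.
  apply: nondeg => a; have [c ->] := genA a; rewrite betaE big1 // => i _.
  by have /ffunP/(_ i) := b0; rewrite !ffunE => ->; rewrite scaler0.
have [g PhiE] := linear_ffun_components Phi.
have /choice[c cP] i := endo_scalar (g i).
exists (\sum_i c i *: e i) => b; rewrite betaE -(PhiP (iota b) (phi b)); last by exists b.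
by rewrite PhiE; apply: eq_bigr => i _; rewrite cP ffunE.
Qed.
End Endomorphisms.
End InjectiveCogenerator.

(** * Extensions and right determined deflations *)

Section ExtSequences.
Variables (k : comPzRingType) (C : exactCat k).
Implicit Types (A B K M T X Y Z : C).

Lemma ext_moveL X Y (E : extension Y X) X' Y' (x' : Ext1 Y' X') f g :
  emor f g (\pi_(Ext1 Y X) E) x' <-> ext_mor f g E (repr x').
Proof. by rewrite -{1}[x']reprK; exact: emor_pi. Qed.

Lemma ext_moveR X Y (x : Ext1 Y X) X' Y' (E' : extension Y' X') f g :
  emor f g x (\pi_(Ext1 Y' X') E') <-> ext_mor f g (repr x) E'.
Proof. by rewrite -{1}[x]reprK; exact: emor_pi. Qed.

Lemma pull_eq0 X Y T (g : Mor T Y) (x : Ext1 Y X) :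
  pull g x = 0 <-> factors_through g (prj (repr x)).
Proof.
split=> [gx0|[t ->]].
  have := emor_pull g x; rewrite gx0 => /ext_moveL[e /= [_ pe]].
  by exists (e \oc in2 _); rewrite compA pe -compA pr2_in2 compm1.
apply: pullE; apply/ext_moveL; exists (inc (repr x) \oc pr1 _ + t \oc pr2 _) => /=.
rewrite compDl compDr -!compA pr1_in1 pr2_in1 !compm1 compm0 addr0; split=> //.
by rewrite compA prj_inc comp0m add0r.
Qed.

Lemma push_eq0 X X' Y (f : Mor X X') (x : Ext1 Y X) :
  push f x = 0 <-> exists t : Mor (mid (repr x)) X', f = t \oc inc (repr x).
Proof.
split=> [fx0|[t ->]].
  have := emor_push f x; rewrite fx0 => /ext_moveR[e /= [ei _]].
  by exists (pr1 _ \oc e); rewrite -compA ei compA pr1_in1 comp1m.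
apply: pushE; apply/ext_moveR; exists (in1 _ \oc t + in2 _ \oc prj (repr x)) => /=.
split; first by rewrite compDl -!compA prj_inc compm0 addr0.
by rewrite compDr !compA pr2_in1 pr2_in2 comp0m add0r.
Qed.

Lemma pull_prj X Y (x : Ext1 Y X) : pull (prj (repr x)) x = 0.
Proof. by apply/pull_eq0; exists (idm _); rewrite compm1. Qed.

Lemma push_inc X Y (x : Ext1 Y X) : push (inc (repr x)) x = 0.
Proof. by apply/push_eq0; exists (idm _); rewrite comp1m. Qed.

(** Exactness of the covariant long sequence of [y] at Ext(T,X). *)
Lemma push_inc_eq0 X Y T (y : Ext1 Y X) (z : Ext1 T X) :
  push (inc (repr y)) z = 0 -> exists g, z = pull g y.
Proof.
move=> /push_eq0[t it].
have [|g gp] := cokernel_desc (ext_cok (repr z)) (t := prj (repr y) \oc t).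
  by rewrite -compA -it prj_inc.
exists g; apply/esym/pullE; exists t; rewrite compm1; split=> //.
Qed.

(** Exactness of the contravariant long sequence of [x] at Ext(Y,Z). *)
Lemma pull_prj_eq0 X Y Z (x : Ext1 Y X) (z : Ext1 Y Z) :
  pull (prj (repr x)) z = 0 -> exists u, z = push u x.
Proof.
move=> /pull_eq0[t pt].
have [|u iu] := kernel_lift (ext_ker (repr z)) (t := t \oc inc (repr x)).
  by rewrite compA -pt prj_inc.
exists u; apply/esym/pushE; exists t; rewrite comp1m; split=> //.
Qed.

Lemma push_linear X X' Y (f : Mor X X') : linear (@push k C X X' Y f).
Proof.
move=> a x y; have [Z [e [g [h [-> ->]]]]] := ext_joint2 x y.
rewrite !ext_scaleE -(pushM f g) -(pushM f h) -!(pushM (a *: _)) -!push_add -pushM.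
congr (push _ e).
by rewrite compDr !compA compZl compZr compm1 comp1m.
Qed.
HB.instance Definition _ X X' Y (f : Mor X X') := GRing.isLinear.Build k
  (Ext1 Y X) (Ext1 Y X') _ (@push k C X X' Y f) (@push_linear X X' Y f).

Lemma push_id_sub X Y (u : Mor X X) (x : Ext1 Y X) :
  push u x = x -> push (idm X - u) x = 0.
Proof.
move=> ux; have := push_add (idm X - u) u x; rewrite subrK push1 ux.
by rewrite -{1}[x]add0r => /addIr.
Qed.

Lemma pull_id_sub X Y (g : Mor Y Y) (x : Ext1 Y X) :
  pull g x = x -> pull (idm Y - g) x = 0.
Proof.
move=> gx; have := pull_add (idm Y - g) g x; rewrite subrK pull1 gx.
by rewrite -{1}[x]add0r => /addIr.
Qed.

Lemma push_split_inj X X' Y (i : Mor X X') (r : Mor X' X) (x : Ext1 Y X) :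
  r \oc i = idm X -> push i x = 0 -> x = 0.
Proof. by move=> ri ix0; rewrite -[x]push1 -ri pushM ix0 raddf0. Qed.

Lemma pull_split_inj X Y Y' (i : Mor Y Y') (r : Mor Y' Y) (x : Ext1 Y X) :
  r \oc i = idm Y -> pull r x = 0 -> x = 0.
Proof. by move=> ri rx0; rewrite -[x]pull1 -ri pullM rx0 raddf0. Qed.

(** Since [idm X - u] kills the nonzero [x], it is not invertible; locality leaves [u]. *)
Lemma push_fixed_iso X Y (u : Mor X X) (x : Ext1 Y X) :
  local_End X -> push u x = x -> x <> 0 -> is_iso u.
Proof.
move=> [_ locX] ux x0; have [||[r [ri _]]] := locX u (idm X - u).
- by rewrite addrC subrK; exact: is_iso_id.
- by [].
by case: x0; apply: push_split_inj ri _; exact: push_id_sub.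
Qed.

Lemma pull_fixed_iso X Y (g : Mor Y Y) (x : Ext1 Y X) :
  local_End Y -> pull g x = x -> x <> 0 -> is_iso g.
Proof.
move=> [_ locY] gx x0; have [||[r [_ ir]]] := locY g (idm Y - g).
- by rewrite addrC subrK; exact: is_iso_id.
- by [].
by case: x0; apply: pull_split_inj ir _; exact: pull_id_sub.
Qed.

(** * Detection and right determinacy *)

Definition detects Z K : Prop :=
  forall T (x : Ext1 T K), (forall h : Mor Z T, pull h x = 0) -> x = 0.

Lemma detects_split_mono Z K K' (i : Mor K' K) (r : Mor K K') :
  r \oc i = idm K' -> detects Z K -> detects Z K'.
Proof.
move=> ri detK T x x0; apply: (push_split_inj ri); apply: detK => h.
by rewrite -pullC x0 raddf0.
Qed.

Lemma right_determined_equiv Z X X' Y (f : Mor X Y) (f' : Mor X' Y) :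
  right_equivalent f f' -> right_determined Z f -> right_determined Z f'.
Proof.
move=> [[a fa] [b fb]] detf T g gf'.
have [h|t ->] := detf T g; last by exists (a \oc t); rewrite fa compA.
by have [t ->] := gf' h; exists (b \oc t); rewrite fb compA.
Qed.

Lemma right_equivalent_sym X X' Y (f : Mor X Y) (f' : Mor X' Y) :
  right_equivalent f f' -> right_equivalent f' f.
Proof. by case. Qed.

Lemma right_equivalent_trans X X' X'' Y (f : Mor X Y) (f' : Mor X' Y) (f'' : Mor X'' Y) :
  right_equivalent f f' -> right_equivalent f' f'' -> right_equivalent f f''.
Proof.
move=> [[a fa] [b f'b]] [[a' f'a'] [b' f''b']]; split.
  by exists (a' \oc a); rewrite fa f'a' compA.
by exists (b \oc b'); rewrite f''b' f'b compA.
Qed.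

Lemma deflation_ext X Y (f : Mor X Y) : deflation f ->
  exists K (x : Ext1 Y K), right_equivalent f (prj (repr x)).
Proof.
move=> [K [i conf_if]]; pose E := Extension conf_if.
exists K, (\pi_(Ext1 Y K) E); set E' := repr _.
have /ext_eqP[e [[e' [_ ee']] _ pe]] : \pi_(Ext1 Y K) E = \pi_(Ext1 Y K) E'.
  by rewrite reprK.
split; first by exists e.
by exists e'; rewrite -[f]/(prj E) -pe -compA ee' compm1.
Qed.

Lemma detects_right_determined Z Y K (x : Ext1 Y K) :
  detects Z K -> right_determined Z (prj (repr x)).
Proof.
move=> det T g gx; apply/pull_eq0/det => h; rewrite -pullM; apply/pull_eq0.
exact: gx.
Qed.

Lemma right_determined_detects Z Y K (x : Ext1 Y K) :
  right_minimal (prj (repr x)) -> right_determined Z (prj (repr x)) -> detects Z K.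
Proof.
set X := mid (repr x); set f := prj (repr x); set i := inc (repr x).
move=> minf detf T y y0; pose w : Ext1 T X := push i y.
suff w0 : w = 0.
  have [g yg] := push_inc_eq0 w0; rewrite yg; apply/pull_eq0; apply: detf => h.
  by apply/pull_eq0; rewrite pullM -yg.
have [e [ei pe]] := emor_push i y; rewrite -/w comp1m in ei pe.
(* A map p : P -> Y from the middle term of w, extending f and vanishing on
   the middle term of y; in terms of pushouts, P is the sum of X and the middle
   term of y, amalgamated along K. *)
have [p [pw pe0]] : exists p : Mor (mid (repr w)) Y,
    p \oc inc (repr w) = f /\ p \oc e = 0.
  (* Pushing [w] along [f] gives 0 because [f \oc i = 0], so [f] extends; a correction through
     [prj (repr w)] then kills [e]. *)
  have [p fp] : exists p : Mor (mid (repr w)) Y, f = p \oc inc (repr w).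
    by apply/push_eq0; rewrite -pushM prj_inc push0.
  have [|g gp] := cokernel_desc (ext_cok (repr y)) (t := p \oc e).
    by rewrite -compA ei compA -fp prj_inc.
  exists (p - g \oc prj (repr w)); rewrite !compBl -!compA prj_inc compm0 subr0.
  by split=> //; rewrite pe gp subrr.
(* Determinacy is applied to [p]: since [y] vanishes on [Z], each [h] from [Z] is a map through [e]
   plus a map through [inc (repr w)], and [p] kills the former. *)
have [h|r pr] := detf _ p.
  have /pull_eq0[s hs] := y0 (prj (repr w) \oc h).
  have [|s' hs'] := kernel_lift (ext_ker (repr w)) (t := h - e \oc s).
    by rewrite compBr hs compA pe subrr.
  exists s'; have -> : h = inc (repr w) \oc s' + e \oc s by rewrite hs' subrK.
  by rewrite compDr !compA pw pe0 comp0m addr0.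
(* Right minimality makes [inc (repr w)] a split monomorphism, so [w = 0]. *)
have [|v [vu _]] := minf (r \oc inc (repr w)).
  by rewrite compA -pr pw.
apply: (push_split_inj vu).
by rewrite pushM push_inc raddf0.
Qed.

(** * Representability through a single linear form *)

Section Representability.
Variables (J : lmodType k) (K : C).

(** Yoneda: [gamma] is the image of the identity of [Z]. *)
Lemma in_Cl_surj : in_Cl J K -> exists Z (gamma : {linear Ext1 Z K -> J}),
  forall T (phi : {linear Ext1 T K -> J}),
    exists f : Mor Z T, forall x, phi x = gamma (pull f x).
Proof.
move=> [Z [eta [eta_bij eta_nat]]].
exists Z, (eta Z (idm (Z : stable C))) => T phi.
have [theta _ etaK] := eta_bij T.
exists (repr (theta phi : stable_hom Z T)) => x.
have := eta_nat Z T (theta phi) (idm (Z : stable C)).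
have -> : fmap (hom_functor (Z : stable C)) (theta phi) (idm (Z : stable C)) = theta phi.
  exact: compm1.
by rewrite etaK => {1}->.
Qed.

Lemma in_Cl_detects : cogenerator J -> in_Cl J K -> exists Z, detects Z K.
Proof.
move=> cogJ /in_Cl_surj[Z [gamma surj]]; exists Z => T x x0.
apply: contrapT => /eqP /cogJ[phi]; have [f ->] := surj T phi.
by rewrite x0 raddf0 eqxx.
Qed.

(** The Yoneda transformation of [gamma] is bijective: the hypotheses are its injectivity on stable
    maps and its surjectivity. *)
Lemma in_ClI Z (gamma : {linear Ext1 Z K -> J}) :
  (forall T (f : Mor Z T), (forall x, gamma (pull f x) = 0) -> projectively_trivial f) ->
  (forall T (phi : {linear Ext1 T K -> J}),
    exists f : Mor Z T, forall x, phi x = gamma (pull f x)) ->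
  in_Cl J K.
Proof.
move=> inj surj; exists Z.
pose eta T (u : stable_hom Z T) : dual J (Ext1 T K) :=
  (gamma \o @pull k C K T Z (repr u) : {linear Ext1 T K -> J}).
have etaE T (f : Mor Z T) x : eta T (\pi_(stable_hom Z T) f) x = gamma (pull f x).
  by congr (gamma _); apply: pull_stable; rewrite reprK.
have eta_lin T : linear (eta T).
  move=> a; elim/quotW=> f; elim/quotW=> g; apply: linear_map_ext => x.
  rewrite stable_ZE stable_addE etaE pull_add pull_scale linearP.
  by rewrite -!etaE.
pose etaL T : {linear stable_hom Z T -> dual J (Ext1 T K)} :=
  HB.pack (eta T) (GRing.isLinear.Build _ _ _ _ _ (eta_lin T)).
exists etaL; split=> [T|T T' v u]; last first.
  apply: linear_map_ext => x; move: v u; elim/quotW=> g; elim/quotW=> f.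
  have -> : fmap (hom_functor (Z : stable C)) (\pi_(stable_hom T T') g) (\pi_(stable_hom Z T) f) =
    \pi_(stable_hom Z T') (g \oc f) by exact: stable_compE.
  rewrite etaE /= pullM -(etaE _ f); congr (eta _ _ _).
  by apply: pull_stable; rewrite reprK.
have eta_ker u : eta T u = 0 -> u = 0.
  elim/quotW: u => f f0; rewrite -[0](raddf0 \pi_(stable_hom Z T)).
  apply/stable_eqP; rewrite subr0; apply/ptrivP/inj => x.
  by rewrite -etaE f0.
have eta_surj phi : exists u, eta T u = phi.
  have [f fP] := surj T phi; exists (\pi_(stable_hom Z T) f).
  by apply: linear_map_ext => x; rewrite etaE fP.
have /choice[theta thetaK] := eta_surj.
exists theta => [u|phi]; last exact: thetaK.
apply/subr0_eq/eta_ker; rewrite -[LHS]/(etaL T _) raddfB.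
by apply/eqP; rewrite subr_eq0; apply/eqP/thetaK.
Qed.
End Representability.

(** * Local summands and right minimal versions *)

Lemma comp_suml n X Y Z (f : 'I_n -> Mor Y Z) (g : Mor X Y) :
  (\sum_i f i) \oc g = \sum_i f i \oc g.
Proof. exact: (raddf_sum (hom_pre g)). Qed.

Lemma comp_sumr n X Y Z (f : Mor Y Z) (g : 'I_n -> Mor X Y) :
  f \oc (\sum_i g i) = \sum_i f \oc g i.
Proof. exact: (raddf_sum (hom_post f)). Qed.

(** Iterated biproducts of local objects, so that proofs can split off one summand and induct on
    their number. *)
Inductive local_sum : nat -> C -> Prop :=
| local_sum0 X : idm X = 0 -> local_sum 0 X
| local_sumS n A R (B : biproduct A R) :
    local_End A -> local_sum n R -> local_sum n.+1 B.

Lemma Krull_Schmidt_local_sum : Krull_Schmidt C -> forall X, exists n : nat, local_sum n X.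
Proof.
move=> KS X; have [n [Xs [inj [prj [dsX locX]]]]] := KS X; exists n.
elim: n Xs X inj prj dsX locX => [|n IHn] Xs X inj prj [pi1 pi0 ip] locX.
  by apply: local_sum0; rewrite -ip big_ord0.
have [R [injR [prjR dsR]]] := exact_additive C n (fun i => Xs (lift ord0 i)).
have locR : local_sum n R by apply: (IHn _ _ _ _ dsR) => i; exact: locX.
have [pi1R pi0R ipR] := dsR.
pose i2 := \sum_i inj (lift ord0 i) \oc prjR i.
pose p2 := \sum_i injR i \oc prj (lift ord0 i).
have p2_inj i : p2 \oc inj (lift ord0 i) = injR i.
  rewrite comp_suml (bigD1 i) //= -compA pi1 compm1 big1 ?addr0 // => j ji.
  by rewrite -compA pi0 ?compm0 // (inj_eq lift_inj) eq_sym.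
have p2_inj0 : p2 \oc inj ord0 = 0.
  by rewrite comp_suml big1 // => j _; rewrite -compA pi0 ?compm0 // neq_lift.
have p2_i2 : p2 \oc i2 = idm R.
  by rewrite comp_sumr -[RHS]ipR; apply: eq_bigr => i _; rewrite compA p2_inj.
have p0_i2 : prj ord0 \oc i2 = 0.
  by rewrite comp_sumr big1 // => j _; rewrite compA pi0 ?comp0m // eq_sym neq_lift.
have i2_p2 : inj ord0 \oc prj ord0 + i2 \oc p2 = idm X.
  rewrite -[RHS]ip big_ord_recl; congr (_ + _).
  rewrite comp_sumr; apply: eq_bigr => i _; rewrite compA; congr (_ \oc _).
  rewrite comp_suml (bigD1 i) //= -compA pi1R compm1 big1 ?addr0 // => j ji.
  by rewrite -compA pi0R ?compm0 // eq_sym.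
exact: (@local_sumS _ _ _ (Biproduct (pi1 ord0) p2_i2 p2_inj0 p0_i2 i2_p2) (locX ord0) locR).
Qed.

Lemma mono_right_inverse_iso X Y (g : Mor X Y) (h : Mor Y X) :
  (forall T (t : Mor T X), g \oc t = 0 -> t = 0) -> g \oc h = idm Y -> is_iso g.
Proof.
move=> mono gh; exists h; split=> //; apply/subr0_eq/mono.
by rewrite compBr compA gh comp1m compm1 subrr.
Qed.

Lemma biproduct_joint X1 X2 (B : biproduct X1 X2) T (s t : Mor T B) :
  pr1 B \oc s = pr1 B \oc t -> pr2 B \oc s = pr2 B \oc t -> s = t.
Proof.
move=> st1 st2; rewrite -[s]comp1m -[t]comp1m -(in_pr B) !compDl -!compA.
by rewrite st1 st2.
Qed.

(* The maps u with t u s never invertible, for s and t to and from the local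
   summands, form the radical; this says that 1 - u is invertible for such u. *)
Lemma nonradical_complement n X (g : Mor X X) : local_sum n X -> ~ is_iso g ->
  exists A (s : Mor A X) (t : Mor X A),
    local_End A /\ t \oc (idm X - g) \oc s = idm A.
Proof.
move=> locX; elim: locX g => {n X} [X X0|n A R B locA _ IHR] g ng.
  case: ng; exists 0; have zero (f : Mor X X) : f = idm X.
    by rewrite -[f]comp1m X0 comp0m.
  by rewrite [_ \oc g]zero [g \oc _]zero.
pose u := idm (bp B) - g.
have [|[a' [a'a aa']]|[a' [a'a _]]] := locA.2 (pr1 B \oc g \oc in1 B) (pr1 B \oc u \oc in1 B).
- rewrite -compDl -compDr addrC subrK compm1 pr1_in1; exact: is_iso_id.
- (* Gaussian elimination with pivot [pr1 g in1]: [v] spans the complement of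
     [in1] on which [pr1 g] vanishes. *)
  pose c := a' \oc (pr1 B \oc u \oc in2 B).
  have [v vE] : exists v, v = in2 B + in1 B \oc c by exists (in2 B + in1 B \oc c).
  have p1gv : pr1 B \oc g \oc v = 0.
    rewrite vE compDr compA /c compA aa' comp1m -compDl -compDr subrKC.
    by rewrite compm1 pr1_in2.
  have p2v : pr2 B \oc v = idm R.
    by rewrite vE compDr compA pr2_in2 pr2_in1 comp0m addr0.
  have [[b' [b'b bb']]|nb] := pselect (is_iso (pr2 B \oc g \oc v)); last first.
    have [A' [s [t [locA' ts]]]] := IHR _ nb.
    exists A', (v \oc s), (t \oc pr2 B); split=> //.
    rewrite -ts -p2v -!compA; congr (t \oc _); rewrite !compA; congr (_ \oc s).
    by rewrite compBr compm1 compBl.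
  (* With the Schur complement [pr2 B \oc g \oc v] invertible, [g] would be too: [h2] completes
     [in1 B \oc a' \oc pr1 B] to a right inverse, and [g] is monic. *)
  have [h2 bh2] : exists h2, pr2 B \oc g \oc v \oc h2 =
      pr2 B - pr2 B \oc g \oc in1 B \oc a' \oc pr1 B.
    by exists (b' \oc (pr2 B - pr2 B \oc g \oc in1 B \oc a' \oc pr1 B)); rewrite compA bb' comp1m.
  case: ng.
  apply: (@mono_right_inverse_iso _ _ _ (in1 B \oc a' \oc pr1 B + v \oc h2)).
    move=> T t gt0.
    have [t1 tE] : exists t1, t = in1 B \oc t1 + v \oc (pr2 B \oc t).
      exists (pr1 B \oc t - c \oc pr2 B \oc t); rewrite compBr vE compDl.
      rewrite -{1}[t]comp1m -(in_pr B) compDl -!compA.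
      by rewrite [X in _ = _ + X]addrC addrA subrK.
    have t10 : t1 = 0.
      rewrite -[t1]comp1m -a'a -compA.
      have -> : pr1 B \oc g \oc in1 B \oc t1 = pr1 B \oc (g \oc t).
        by rewrite [in RHS]tE !compDr !compA p1gv !comp0m addr0.
      by rewrite gt0 !compm0.
    rewrite tE t10 compm0 add0r -[pr2 B \oc t]comp1m -b'b -compA.
    have -> : pr2 B \oc g \oc v \oc (pr2 B \oc t) = pr2 B \oc (g \oc t).
      by rewrite [in RHS]tE t10 compm0 add0r !compA.
    by rewrite gt0 !compm0.
  apply: (@biproduct_joint _ _ B); rewrite compm1 !compDr !compA.
    by rewrite p1gv comp0m addr0 aa' comp1m.
  by rewrite bh2 subrKC.
exists A, (in1 B), (a' \oc pr1 B); split=> //.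
by rewrite -a'a !compA.
Qed.

(** The idempotent [b \oc a] or its complement is invertible. In the first case it is the identity;
    in the second [b = 0], which is impossible as [A'] is nonzero. *)
Lemma local_split_epi A A' (a : Mor A A') (b : Mor A' A) :
  local_End A -> local_End A' -> a \oc b = idm A' -> b \oc a = idm A.
Proof.
move=> [_ locA] [nzA' _] ab.
have idem : (b \oc a) \oc (b \oc a) = b \oc a.
  by rewrite compA -(compA b) ab compm1.
have [|[e' [e'e _]]|[e' [e'e _]]] := locA (b \oc a) (idm A - b \oc a).
- by rewrite addrC subrK; exact: is_iso_id.
- by rewrite -[b \oc a]comp1m -e'e -compA idem e'e.
case: nzA'; have b0 : b = 0.
  by rewrite -[b]comp1m -e'e -compA compBl comp1m -compA ab compm1 subrr compm0.
by exists 0; rewrite -ab b0 !compm0.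
Qed.

(** Exchange: [t] is an isomorphism on some local summand of [X], and the other summands form [R].
    The section [s] may be replaced by another map [q]. *)
Lemma local_sum_cancel n X A (s : Mor A X) (t : Mor X A) :
  local_sum n X -> local_End A -> t \oc s = idm A ->
  exists m R (j : Mor R X) (r : Mor X R) (q : Mor A X),
    [/\ n = m.+1, local_sum m R & q \oc t + j \oc r = idm X].
Proof.
move=> locX locA; elim: locX s t => {n X} [X X0|n A' R B locA' locR IHR] s t ts.
  case: locA => nzA _; case: nzA; exists 0.
  have -> : idm A = 0 by rewrite -ts -[s]comp1m X0 comp0m compm0.
  by rewrite !compm0.
have split1 (f : Mor B B) : f = f \oc in1 B \oc pr1 B + f \oc in2 B \oc pr2 B.
  by rewrite -!compA -compDr in_pr compm1.
have [|[c [_ vc]]|[c [_ wc]]] :=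
  locA.2 (t \oc in1 B \oc (pr1 B \oc s)) (t \oc in2 B \oc (pr2 B \oc s)).
- by rewrite !compA -compDl -!compA -compDr in_pr compm1 ts; exact: is_iso_id.
- have [q0 tq0] : exists q0, t \oc in1 B \oc q0 = idm A.
    by exists (pr1 B \oc s \oc c); rewrite compA.
  have q0t := local_split_epi locA' locA tq0.
  (* The map in parentheses projects onto the kernel of [t] and kills [in1 B], so it factors through
     [pr2 B]. *)
  exists n, R, ((idm _ - in1 B \oc q0 \oc t) \oc in2 B), (pr2 B), (in1 B \oc q0).
  split=> //; rewrite [LHS]addrC; set p := idm _ - _.
  have p1 : p \oc in1 B = 0.
    by rewrite compBl comp1m -!compA q0t compm1 subrr.
  have := split1 p; rewrite p1 comp0m add0r => <-.
  by rewrite subrK.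
have [|m [R1 [j1 [r1 [q1 [nm locR1 qjr]]]]]] := IHR (pr2 B \oc s \oc c) (t \oc in2 B).
  by rewrite !compA -(compA _ (pr2 B)) wc.
have [B1 _] := biproduct_exists (exact_additive C) A' R1.
have [p pE] : exists p, p = idm (bp B) - in2 B \oc q1 \oc t.
  by exists (idm (bp B) - in2 B \oc q1 \oc t).
exists m.+1, B1, (p \oc in1 B \oc pr1 B1 + in2 B \oc j1 \oc pr2 B1).
exists (in1 B1 \oc pr1 B + in2 B1 \oc r1 \oc pr2 B), (in2 B \oc q1); split.
- by rewrite nm.
- exact: local_sumS.
have p2 : p \oc in2 B = in2 B \oc j1 \oc r1.
  rewrite pE compBl comp1m -!compA -{1}[in2 B]compm1 -compBr -qjr.
  by rewrite [q1 \oc _ + _]addrC addrK.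
rewrite !compDl !compDr -!compA !(compA (pr1 B1)) !(compA (pr2 B1)).
rewrite pr1_in1 pr1_in2 pr2_in1 pr2_in2 !comp0m !comp1m !compm0 addr0 add0r.
have := split1 p; rewrite p2 -!compA => <-.
by rewrite pE -!compA subrKC.
Qed.

(** A lift [e] of the inverse of [u] gives [g \oc e = idm _ + c \oc f] with [f \oc c = 0], whose
    inverse is [idm _ - c \oc f]. *)
Lemma conflation_endo_iso X Y (x : Ext1 Y X) (g : Mor (mid (repr x)) (mid (repr x)))
    (u : Mor X X) : g \oc inc (repr x) = inc (repr x) \oc u ->
  prj (repr x) \oc g = prj (repr x) -> is_iso u -> is_iso g.
Proof.
set i := inc _; set f := prj _ => gi fg [u' [u'u uu']].
have ux : push u x = x by apply: pushE; exists g; rewrite comp1m.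
have [e [ei fe]] : emor u' (idm Y) x x.
  by have := emor_push u' x; rewrite -{2}ux -pushM u'u push1.
rewrite -/i in ei; rewrite comp1m -/f in fe.
have [|c cf] := cokernel_desc (ext_cok (repr x)) (t := g \oc e - idm _).
  by rewrite compBl comp1m -compA ei compA gi -compA uu' compm1 subrr.
rewrite -/f in cf.
have fc0 : f \oc c = 0.
  apply: (cokernel_epi (ext_cok (repr x))).
  by rewrite comp0m -compA -/f cf compBr compm1 compA fg fe subrr.
apply: (@mono_right_inverse_iso _ _ _ (e \oc (idm _ - c \oc f))) => [T t gt0|].
  have [|s it] := kernel_lift (ext_ker (repr x)) (t := t).
    by rewrite -/f -fg -compA gt0 compm0.
  rewrite -/i in it; rewrite -it -[s]comp1m -u'u -compA.
  have -> : u \oc s = 0; last by rewrite !compm0.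
  apply: (kernel_mono (ext_ker (repr x))); rewrite -/i compA -gi -compA it gt0.
  by rewrite compm0.
have geE : g \oc e = idm _ + c \oc f by rewrite cf subrKC.
by rewrite compA geE compBr compm1 compDl comp1m -compA (compA f) fc0 comp0m compm0 addr0 addrK.
Qed.

(* If [x] is not right minimal, some endomorphism [u] of its kernel with
   [u_* x = x] is not invertible; then [1 - u] kills [x] and is invertible on a
   local summand, which can be split off. *)
Lemma right_minimal_version n K Y (x : Ext1 Y K) : local_sum n K ->
  exists K' (x' : Ext1 Y K'),
    right_minimal (prj (repr x')) /\ right_equivalent (prj (repr x)) (prj (repr x')).
Proof.
elim/ltn_ind: n K x => n IHn K x locK.
have [minx|not_min] := pselect (right_minimal (prj (repr x))).
  by exists K, x; split=> //; split; exists (idm _); rewrite compm1.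
have [g [fg ng]] : exists g, prj (repr x) \oc g = prj (repr x) /\ ~ is_iso g.
  apply: contrapT => no_g; apply: not_min => g fg; apply: contrapT => ng.
  by apply: no_g; exists g.
have [|u iu] := kernel_lift (ext_ker (repr x)) (t := g \oc inc (repr x)).
  by rewrite compA fg prj_inc.
have ux : push u x = x by apply: pushE; exists g; rewrite comp1m.
have nu : ~ is_iso u.
  by move=> isou; apply: ng; exact: conflation_endo_iso (esym iu) fg isou.
have [A [s [t [locA tus]]]] := nonradical_complement locK nu.
have [m [R [j [r [q [nm locR qjr]]]]]] := local_sum_cancel locK locA tus.
(* The retraction split off is [t \oc (idm K - u)], which kills [x]; so [x] is recovered from its
   component on [R]. *)
have xE : push j (push r x) = x.
  rewrite -[RHS]push1 -qjr push_add !pushM (push_id_sub ux) !raddf0.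
  by rewrite add0r.
have [|K' [x' [minx' eqx']]] := IHn m _ R (push r x) locR; first by rewrite nm.
exists K', x'; split=> //; apply: right_equivalent_trans eqx'; split.
  by have [e [_ pe]] := emor_push r x; exists e; rewrite pe comp1m.
have [e [_ pe]] : emor j (idm Y) (push r x) x by rewrite -{2}xE; exact: emor_push.
by exists e; rewrite pe comp1m.
Qed.

(** * Almost split conflations *)

Section DualRepresentability.
Variable J : lmodType k.

(** The criterion of [in_ClI], which is additive in [K] without reference to the stable category. *)
Definition dual_representable K : Prop := exists Z (gamma : {linear Ext1 Z K -> J}),
  (forall T (f : Mor Z T), (forall x, gamma (pull f x) = 0) -> projectively_trivial f) /\
  (forall T (phi : {linear Ext1 T K -> J}),
     exists f : Mor Z T, forall x, phi x = gamma (pull f x)).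

Lemma dual_representable_in_Cl K : dual_representable K -> in_Cl J K.
Proof. by move=> [Z [gamma [inj surj]]]; exact: in_ClI inj surj. Qed.

Lemma projectively_trivial0 X Y : projectively_trivial (0 : Mor X Y).
Proof. by apply/ptrivP; exact: rpred0. Qed.

Lemma dual_representable_injective K :
  (forall T (x : Ext1 T K), x = 0) -> dual_representable K.
Proof.
move=> K0; have [Z [inj [prj [_ _]]]] := exact_additive C 0%N (fun=> K).
rewrite big_ord0 => Z0; exists Z, (\0 : {linear Ext1 Z K -> J}); split.
  by move=> T f _; rewrite -[f]compm1 -Z0 compm0; exact: projectively_trivial0.
by move=> T phi; exists 0 => x; rewrite [x]K0 raddf0.
Qed.

Lemma dual_representable_biproduct K1 K2 (B : biproduct K1 K2) :
  dual_representable K1 -> dual_representable K2 -> dual_representable B.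
Proof.
move=> [Z1 [g1 [inj1 surj1]]] [Z2 [g2 [inj2 surj2]]].
have [Z _] := biproduct_exists (exact_additive C) Z1 Z2.
pose gamma : {linear Ext1 Z B -> J} :=
  (g1 \o @pull k C K1 Z Z1 (in1 Z) \o @push k C B K1 Z (pr1 B)) \+
  (g2 \o @pull k C K2 Z Z2 (in2 Z) \o @push k C B K2 Z (pr2 B)).
have gammaE T (f : Mor Z T) x : gamma (pull f x) =
    g1 (pull (f \oc in1 Z) (push (pr1 B) x)) + g2 (pull (f \oc in2 Z) (push (pr2 B) x)).
  by rewrite /gamma /= !pullC !pullM.
exists Z, gamma; split=> T.
  move=> f f0.
  suff [f1 f2] : projectively_trivial (f \oc in1 Z) /\
      projectively_trivial (f \oc in2 Z).
    rewrite -[f]compm1 -(in_pr Z) compDr !compA; apply/ptrivP.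
    by apply: rpredD; apply: ptriv_compr; apply/ptrivP.
  split; [apply: inj1|apply: inj2] => x.
    have := f0 (push (in1 B) x); rewrite gammaE -!pushM pr1_in1 pr2_in1 push1.
    by rewrite push0 raddf0 raddf0 addr0.
  have := f0 (push (in2 B) x); rewrite gammaE -!pushM pr2_in2 pr1_in2 push1.
  by rewrite push0 raddf0 raddf0 add0r.
move=> phi.
have [f1 f1P] := surj1 T (phi \o @push k C K1 B T (in1 B) : {linear Ext1 T K1 -> J}).
have [f2 f2P] := surj2 T (phi \o @push k C K2 B T (in2 B) : {linear Ext1 T K2 -> J}).
exists (f1 \oc pr1 Z + f2 \oc pr2 Z) => x.
rewrite gammaE !compDl -!compA pr1_in1 pr1_in2 pr2_in1 pr2_in2 !compm1 !compm0.
rewrite addr0 add0r -f1P -f2P /= -raddfD -!pushM -push_add in_pr.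
by rewrite push1.
Qed.

Lemma local_sum_pull_neq0 n Z K (x : Ext1 Z K) : local_sum n Z -> x <> 0 ->
  exists Z' (i : Mor Z' Z), local_End Z' /\ pull i x <> 0.
Proof.
move=> locZ; elim: locZ x => {n Z} [Z Z0|n A R B locA _ IHR] x x0.
  by case: x0; rewrite -[x]pull1 Z0 projectively_trivial0.
have [x1|] := pselect (pull (in1 B) x = 0); last by exists A, (in1 B).
have [x2|/IHR[Z' [i [locZ' ix]]]] := pselect (pull (in2 B) x = 0); last first.
  by exists Z', (in2 B \oc i); rewrite pullM.
by case: x0; rewrite -[x]pull1 -(in_pr B) pull_add !pullM x1 x2 !raddf0 addr0.
Qed.

Hypotheses (artk : artinian_ring k) (minJ : minimal_injective_cogenerator J).
Hypothesis hom_fg : Hom_finite C.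

(* [z] generates a simple submodule of Ext(Z,K) over End(Z), pulled back to a
   local summand of Z. *)
Lemma exists_right_almost_split n Z K T (x : Ext1 T K) : local_sum n Z ->
  detects Z K -> x <> 0 -> exists Z' (z : Ext1 Z' K), [/\ local_End Z', z <> 0 &
    forall W (g : Mor W Z'), pull g z <> 0 -> exists s : Mor Z' W, is_iso (g \oc s)].
Proof.
move=> locZ detZ x0.
have nonzero W (y : Ext1 W K) : y <> 0 -> exists h : Mor Z W, pull h y <> 0.
  move=> y0; apply: contrapT => no_h; apply: y0; apply: detZ => h.
  by apply: contrapT => hy; apply: no_h; exists h.
have [h0 h0x] := nonzero _ _ x0.
(* The cyclic End(Z)-submodules of Ext(Z,K) are pulled back to End(Z), where finite generation over
   [k] gives the chain condition. *)
pose orbit (h g : Mor Z Z) := exists g', pull g (pull h0 x) = pull g' (pull h (pull h0 x)).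
have [||h [hx minh]] := @artinian_minimal _ _ _ (fun h => pull h (pull h0 x) <> 0) orbit
    (idm Z) (fg_artinian artk (hom_fg Z Z)).
- move=> h; split=> [|a g g' [f fE] [f' fE']].
    by exists 0; rewrite !projectively_trivial0.
  by exists (a *: f + f'); rewrite !pull_add !pull_scale fE fE'.
- by rewrite pull1.
set y := pull h (pull h0 x) in hx.
have [Z' [i [locZ' iy]]] := local_sum_pull_neq0 locZ hx.
exists Z', (pull i y); split=> // W g gz.
have [h' h'gz] := nonzero _ _ gz.
(* By minimality [y] is recovered from its pullback along [i \oc (g \oc h')], so
   [g \oc (h' \oc g' \oc i)] fixes the nonzero class on the local object [Z']. *)
have [|||g' g'E] := minh (h \oc (i \oc (g \oc h'))) _ _ h.
- by rewrite !pullM.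
- by move=> g1 [g' g1E]; exists (i \oc (g \oc h') \oc g'); rewrite g1E !pullM.
- by exists (idm Z); rewrite pull1.
exists (h' \oc g' \oc i); apply: (pull_fixed_iso locZ' _ iy).
by rewrite !pullM; rewrite !pullM -/y in g'E; rewrite -g'E.
Qed.

(** * From right almost split to a perfect pairing *)

Section AlmostSplit.
Variables (Z K : C) (z : Ext1 Z K).
Hypotheses (locK : local_End K) (z0 : z <> 0).
Hypothesis right_split : forall W (g : Mor W Z),
  pull g z <> 0 -> exists s : Mor Z W, is_iso (g \oc s).

Lemma almost_split_prj X (w : Ext1 Z X) : w <> 0 -> pull (prj (repr w)) z = 0.
Proof.
move=> w0; apply: contrapT => /right_split[s [r [_ sr]]]; apply: w0.
by rewrite -[w]pull1 -sr !pullM pull_prj !raddf0.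
Qed.

Lemma almost_split_push X (w : Ext1 Z X) : w <> 0 -> exists u, push u w = z.
Proof.
by move=> /almost_split_prj/pull_prj_eq0[u ->]; exists u.
Qed.

(** If [inc (repr y)] does not kill [z], some [u] brings the pushout back to [z]; then
    [u \oc inc (repr y)] is invertible by locality of [K], so [y] splits. *)
Lemma almost_split_pull W (y : Ext1 W K) : y <> 0 -> exists f, pull f y = z.
Proof.
move=> y0; have [/push_inc_eq0[f ->]|] := pselect (push (inc (repr y)) z = 0).
  by exists f.
move=> /almost_split_push[u]; rewrite -pushM => uz.
have [r [ru _]] := push_fixed_iso locK uz z0.
by case: y0; apply: (push_split_inj ru); rewrite pushM push_inc raddf0.
Qed.

Lemma almost_split_dual_representable : dual_representable K.
Proof.
have [_ cogJ _] := minJ.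
have [gamma /eqP gz] := cogJ _ z (introN eqP z0).
exists Z, gamma; split=> T.
  (* A nonzero pullback along [f] could be pushed to [z], where [gamma] does not vanish. *)
  move=> f f0 X w; apply: contrapT => fw; have [u uw] := almost_split_push fw.
  by apply: gz; rewrite -uw pullC f0.
move=> phi; apply: (pairing_represents artk minJ (hom_fg Z T)
  (beta := fun f x => gamma (pull f x))).
- by move=> x a f g; rewrite pull_add pull_scale linearP.
- by move=> f a x y; rewrite !linearP.
- move=> x x0; apply: contrapT => /almost_split_pull[f fx].
  by apply: gz; rewrite -fx x0.
Qed.
End AlmostSplit.

Lemma detects_dual_representable n m Z K :
  local_sum n Z -> local_sum m K -> detects Z K -> dual_representable K.
Proof.
move=> locZ locK; elim: locK => {m K} [K K0 _|m A R B locA _ IHR detB].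
  apply: dual_representable_injective => T x.
  by rewrite -[x]push1 K0 push0.
apply: dual_representable_biproduct; last first.
  exact: IHR (detects_split_mono (pr2_in2 B) detB).
have detA := detects_split_mono (pr1_in1 B) detB.
(* No almost split conflation starts at an injective [A]; the zero object represents its functor. *)
have [A_inj|] := pselect (forall T (x : Ext1 T A), x = 0).
  exact: dual_representable_injective.
move=> /existsNP[T /existsNP[x x0]].
have [Z' [z [_ z0 split_z]]] := exists_right_almost_split locZ detA x0.
exact: almost_split_dual_representable locA z0 split_z.
Qed.
End DualRepresentability.
End ExtSequences.

Theorem theorem5p4 (k : comPzRingType) (kcheck : lmodType k) (C : exactCat k)
    (X Y : C) (alpha : Mor X Y) :
  artinian_ring k ->
  minimal_injective_cogenerator kcheck ->
  Hom_finite C ->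
  Krull_Schmidt C ->
  deflation alpha ->
  (exists Z : C, right_determined Z alpha) <->
  (exists K : C, is_intrinsic_kernel alpha K /\ in_Cl kcheck K).
Proof.
move=> artk minJ hom_fg /Krull_Schmidt_local_sum KS defl.
have [K0 [x0 eq_x0]] := deflation_ext defl.
have [n locK0] := KS K0.
have [K [x [minx eq_x]]] := right_minimal_version x0 locK0.
have {x0 eq_x0 locK0 eq_x} eq_x := right_equivalent_trans eq_x0 eq_x.
have kerK : is_intrinsic_kernel alpha K.
  exists (mid (repr x)), (prj (repr x)), (inc (repr x)); split=> //.
  exact: ext_ker.
split=> [[Z det_alpha]|[K' [kerK' ClK']]].
  exists K; split=> //; apply: dual_representable_in_Cl.
  have [m locZ] := KS Z; have [p locK] := KS K.
  apply: (detects_dual_representable artk minJ hom_fg locZ locK).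
  exact/(right_determined_detects minx)/(right_determined_equiv eq_x).
have [_ cogJ _] := minJ; have [Z detK'] := in_Cl_detects cogJ ClK'; exists Z.
(* Detection passes from [K'] to the isomorphic [K], the kernel of the chosen right minimal
   version. *)
have [u [v [vu _]]] := intrinsic_kernel_unique kerK kerK'.
apply: (right_determined_equiv (right_equivalent_sym eq_x)).
exact/detects_right_determined/(detects_split_mono vu).
Qed.
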